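(* Let $(\mathcal{X},\mu)$ be a probability space, let $\Theta\subset\mathbb{R}^d$ be a nonempty compact convex set, and let $L:\mathcal{X}\times\Theta\to\mathbb{R}$ be a loss function (measurable in its first argument). Put $F(\theta):=\log\int_{\mathcal{X}}e^{L(x,\theta)}\,d\mu(x)$ and $F^\star:=\min_{\theta\in\Theta}F(\theta)$. Assume that: (1) $L(x,\cdot)$ is convex for every $x\in\mathcal{X}$; (2) there is a stochastic subgradient oracle $g(x,\theta)\in\partial_\theta L(x,\theta)$ and a constant $M\ge 0$ such that, for $X\sim\mu$, $\mathbb{E}\|g(X,\theta)\|^2\le M^2$ for every $\theta\in\Theta$; (3) the numbers $\underline{F},U\in\mathbb{R}$ satisfy $\underline{F}\le F^\star\le U$; (4) $\Theta^\star:=\arg\min_{\theta\in\Theta}F(\theta)$ is nonempty; (5) $\hat\varkappa:=\sup_{\theta\in\Theta}\varkappa(L(\cdot,\theta);\mu)<\infty$. Let $\rho\in\left(0,\frac{1}{2\hat\varkappa}\right)$, let $\mathcal{A}:=[\underline{F}-2\hat\varkappa\rho,\,U]$, let $(\theta_1,\alpha_1)\in\Theta\times\mathcal{A}$, and suppose that the constant $D_\star$ satisfies $\operatorname{dist}(\theta_1,\Theta^\star)\le D_\star$. Define $$R^2:=D_\star^2+(U-\underline{F}+2\rho\hat\varkappa)^2 .$$ Run $N$ iterations of the projected stochastic subgradient method for $\min_{\theta\in\Theta,\,\alpha\in\mathcal{A}}G_\rho(\theta,\alpha)$, initialized at $(\theta_1,\alpha_1)$, with constant stepsize $$\eta=\frac{\rho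 R}{\sqrt{N(M^2+1)}} .$$ Then the averaged iterate $(\bar\theta_N,\bar\alpha_N):=\frac1N\sum_{k=1}^N(\theta_k,\alpha_k)$ satisfies $$\mathbb{E}[F(\bar\theta_N)-F^\star]\le\frac{R\sqrt{M^2+1}}{\rho\sqrt{N}}+2\rho\hat\varkappa .$$
   Context: For a measurable function $\varphi$ on $\mathcal{X}$, $F(\varphi;\mu):=\log\int_{\mathcal{X}}e^{\varphi}\,d\mu$ and, when $F(2\varphi;\mu)<\infty$, $\varkappa(\varphi;\mu):=e^{F(2\varphi;\mu)-2F(\varphi;\mu)}$. Finiteness of $\hat\varkappa$ includes the requirement that $F(2L(\cdot,\theta);\mu)<\infty$ for all $\theta\in\Theta$. Thus $F(\theta)=F(L(\cdot,\theta);\mu)$. The objective is $$G_\rho(\theta,\alpha):=\alpha-1+\frac1\rho\int_{\mathcal{X}}\log\left(1+\rho e^{L(x,\theta)-\alpha}\right)d\mu(x).$$ With $\sigma(t):=e^t/(1+e^t)$, its stochastic subgradient at $(\theta,\alpha)$ is $$g_\rho(x,\theta,\alpha):=\begin{bmatrix}\rho^{-1}\sigma(L(x,\theta)-\alpha+\log\rho)\,g(x,\theta)\\ 1-\rho^{-1}\sigma(L(x,\theta)-\alpha+\log\rho)\end{bmatrix}.$$ The projected stochastic subgradient method is $(\theta_{k+1},\alpha_{k+1})=\Pi_{\Theta\times\mathcal{A}}\big((\theta_k,\alpha_k)-\eta\,g_\rho(X_k,\theta_k,\alpha_k)\big)$, $k=1,2,\dots$, where $X_1,X_2,\dots$ are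 i.i.d. with law $\mu$, $\Pi_{\Theta\times\mathcal{A}}$ is the Euclidean projection onto $\Theta\times\mathcal{A}$, and the initial point is fixed (deterministic). $\|\cdot\|$ is the Euclidean norm and $\operatorname{dist}$ is the Euclidean distance to a set. *)

(* Defs.v *)
From HB Require Import structures.
From mathcomp Require Import all_boot all_order all_algebra finmap.
From mathcomp Require Import all_classical all_reals all_analysis.

Set Implicit Arguments.
Unset Strict Implicit.
Unset Printing Implicit Defensive.

Import Order.TTheory GRing.Theory Num.Theory.
Import numFieldNormedType.Exports.

Local Open Scope classical_set_scope.
Local Open Scope ring_scope.

(* R^d with its Borel sigma-algebra. *)
Notation borel_rV R d := (g_sigma_algebraType (@open 'rV[R]_d)).

Definition argmin (R : realType) (T : Type) (C : set T) (f : T -> \bar R) :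
    set T :=
  [set x | C x /\ forall y, C y -> (f x <= f y)%E].

(* Borel measurability of the oracle on X x Theta: it is what makes the iterates
   of the method random variables. *)
Definition jointly_measurable (dX : measure_display) (X : measurableType dX)
    (R : realType) (d : nat) (Theta : set 'rV[R]_d)
    (g : X -> 'rV[R]_d -> 'rV[R]_d) : Prop :=
  measurable_fun ([set p | Theta p.2] : set (X * borel_rV R d))
    (fun p => g p.1 p.2 : borel_rV R d).

Section euclidean.
Context {R : realType} {d : nat}.
Implicit Types (u v : 'rV[R]_d) (z : 'rV[R]_d * R).

Definition dotp u v : R := \sum_(i < d) u 0 i * v 0 i.

(* The library norm on 'rV[R]_d is the sup norm. *)
Definition eucl_norm u : R := Num.sqrt (dotp u u).

Definition eucl_dist u (S : set 'rV[R]_d) : R := inf [set eucl_norm (u - v) | v in S].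

(* Euclidean norm on R^d x R. *)
Definition eucl_norm2 z : R := Num.sqrt (eucl_norm z.1 ^+ 2 + z.2 ^+ 2).

(* Euclidean projection onto C; the default value z is never used when C is
   nonempty, closed and convex, in which case the minimizer is unique. *)
Definition eucl_proj (C : set ('rV[R]_d * R)) z : 'rV[R]_d * R :=
  xget z (argmin C (fun p => (eucl_norm2 (z - p))%:E)).

(* [f] is only relevant on [D], so the inequality ranges over [D]. *)
Definition subdifferential (D : set 'rV[R]_d) (f : 'rV[R]_d -> R) u :
    set 'rV[R]_d :=
  [set v | forall w, D w -> f u + dotp v (w - u) <= f w].

End euclidean.

Section log_exp.
Context {d : measure_display} {X : measurableType d} {R : realType}.
Local Open Scope ereal_scope.

Definition logint (mu : probability X R) (phi : X -> R) : \bar R :=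
  lne (\int[mu]_x (expR (phi x))%:E).

(* Meaningful only when logint mu (2 phi) < +oo: otherwise the difference may
   be (+oo) - (+oo), so finiteness has to be required separately. *)
Definition kappa (mu : probability X R) (phi : X -> R) : \bar R :=
  expeR (logint mu (fun x => 2 * phi x)%R - 2%:E * logint mu phi).

End log_exp.

Definition sigmoid {R : realType} (t : R) : R := expR t / (1 + expR t).

Section method.
Context {R : realType} {d : nat} {X : Type}.
Variables (L : X -> 'rV[R]_d -> R) (g : X -> 'rV[R]_d -> 'rV[R]_d) (rho : R).

(* Stochastic subgradient at z = (theta, alpha) of
   G_rho(theta, alpha) =
     alpha - 1 + rho^-1 * \int ln (1 + rho * expR (L x theta - alpha)) dmu(x). *)
Definition g_rho (x : X) (z : 'rV[R]_d * R) : 'rV[R]_d * R :=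
  let s := rho^-1 * sigmoid (L x z.1 - z.2 + ln rho) in
  (s *: g x z.1, 1 - s).

Variables (C : set ('rV[R]_d * R)) (eta : R) (z1 : 'rV[R]_d * R).

(* The iterates and the samples are indexed from 0. *)
Fixpoint psgd (xs : nat -> X) (k : nat) : 'rV[R]_d * R :=
  if k is k'.+1 then
    let z := psgd xs k' in
    let h := g_rho (xs k') z in
    eucl_proj C (z.1 - eta *: h.1, z.2 - eta * h.2)
  else z1.

Definition psgd_avg_theta (xs : nat -> X) (N : nat) : 'rV[R]_d :=
  N%:R^-1 *: \sum_(k < N) (psgd xs k).1.

End method.

Section iid.
Context {dO dX : measure_display} {Omega : measurableType dO}
  {X : measurableType dX} {R : realType} (Pr : probability Omega R).
Local Open Scope ereal_scope.

Definition mutually_independent (xi : nat -> {RV Pr >-> X}) : Prop :=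
  forall (J : {fset nat}) (A : nat -> set X), (forall j, measurable (A j)) ->
    Pr (\bigcap_(j in [set` J]) (xi j @^-1` A j)) =
    \prod_(j <- J) Pr (xi j @^-1` A j).

Definition iid_with_law (mu : probability X R) (xi : nat -> {RV Pr >-> X}) :
    Prop :=
  mutually_independent xi /\
  forall k (A : set X), measurable A -> distribution Pr (xi k) A = mu A.

End iid.

(* Main.v *)
(** Write G(theta, alpha) = alpha - 1 + rho^-1 E ln (1 + rho e^(L - alpha)).  The
    integrand is jointly convex in (theta, alpha) because ln (1 + rho e^t) is
    convex and nondecreasing in t, and g_rho is a subgradient of it with second
    moment at most (M^2 + 1) / rho^2; so the usual telescoping argument bounds
    the average of E G(z_k) by G(theta_0, F_0) plus the optimisation error, for
    any minimiser theta_0 of F, with F_0 = F(theta_0).  Next, G(theta_0, F_0) is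
    at most F_0 since ln (1 + u) <= u.  Conversely G(theta, alpha) is at least
    F(theta) - 2 rho khat for every alpha: with s = F(theta) - alpha and
    u = rho e^(L - F(theta)), the function s |-> ln (1 + u e^s) is convex, and its
    tangents at 0 and 1 are bounded below by quadratics in u whose integrals are
    known.

    Two measure-theoretic points.  The iterate z_k is measurable with respect to
    the past samples, which requires L to be jointly measurable: this is not
    assumed, but L(x, .) is recovered from the jointly measurable subgradient as
    a limit of Riemann sums along segments.  And the distance to the minimisers
    is only an infimum, so the bound is first proved up to an arbitrary delta. *)
Require Import Defs.
From HB Require Import structures.
From mathcomp Require Import all_boot all_order all_algebra finmap.
From mathcomp Require Import all_classical all_reals all_analysis.
From mathcomp Require Import measurable_realfun ring lra.

Set Implicit Arguments.
Unset Strict Implicit.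
Unset Printing Implicit Defensive.

Import Order.TTheory GRing.Theory Num.Theory.
Import numFieldNormedType.Exports.

Local Open Scope classical_set_scope.
Local Open Scope ring_scope.

(** * Euclidean inner product on row vectors *)

Section dotp_theory.
Context {R : realType} {d : nat}.
Implicit Types (u v w : 'rV[R]_d) (a : R).

Lemma dotpC u v : dotp u v = dotp v u.
Proof. by apply: eq_bigr => i _; rewrite mulrC. Qed.

Lemma dotpDl u v w : dotp (u + v) w = dotp u w + dotp v w.
Proof. by rewrite -big_split; apply: eq_bigr => i _; rewrite mxE mulrDl. Qed.

Lemma dotpZl a u v : dotp (a *: u) v = a * dotp u v.
Proof. by rewrite mulr_sumr; apply: eq_bigr => i _; rewrite mxE mulrA. Qed.

Lemma dotpNl u v : dotp (- u) v = - dotp u v.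
Proof. by rewrite -scaleN1r dotpZl mulN1r. Qed.

Lemma dotpDr u v w : dotp u (v + w) = dotp u v + dotp u w.
Proof. by rewrite dotpC dotpDl !(dotpC u). Qed.

Lemma dotpZr a u v : dotp u (a *: v) = a * dotp u v.
Proof. by rewrite dotpC dotpZl dotpC. Qed.

Lemma dotpNr u v : dotp u (- v) = - dotp u v.
Proof. by rewrite dotpC dotpNl dotpC. Qed.

Lemma dotp0r u : dotp u 0 = 0.
Proof. by rewrite -(scale0r 0) dotpZr mul0r. Qed.

Definition dotpE := (dotpDl, dotpDr, dotpZl, dotpZr, dotpNl, dotpNr).

Lemma dotp_sumr u n (f : 'I_n -> 'rV[R]_d) :
  dotp u (\sum_(k < n) f k) = \sum_(k < n) dotp u (f k).
Proof.
apply: (big_ind2 (fun v a => dotp u v = a)) => // [|v a w b <- <-].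
  exact: dotp0r.
exact: dotpDr.
Qed.

Lemma dotpxx_ge0 u : 0 <= dotp u u.
Proof. by apply: sumr_ge0 => i _; rewrite -expr2 sqr_ge0. Qed.

Lemma sqr_coord_le_dotp u i : u 0 i ^+ 2 <= dotp u u.
Proof.
rewrite /dotp (bigD1 i)//= expr2 lerDl.
by apply: sumr_ge0 => j _; rewrite -expr2 sqr_ge0.
Qed.

Lemma dotpxx_eq0 u : dotp u u <= 0 -> u = 0.
Proof.
move=> u0; apply/rowP => i; rewrite mxE; apply/eqP; rewrite -sqrf_eq0.
by rewrite eq_le sqr_ge0 andbT (le_trans (sqr_coord_le_dotp u i)).
Qed.

Lemma sqr_eucl_norm u : eucl_norm u ^+ 2 = dotp u u.
Proof. by rewrite sqr_sqrtr// dotpxx_ge0. Qed.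

Lemma eucl_norm2E (z : 'rV[R]_d * R) :
  eucl_norm2 z = Num.sqrt (dotp z.1 z.1 + z.2 ^+ 2).
Proof. by rewrite /eucl_norm2 sqr_eucl_norm. Qed.

Lemma cvg_sumr (T I : Type) (F : set_system T) {FF : Filter F} (r : seq I)
    (f : I -> T -> R) (l : I -> R) :
  (forall i, f i @ F --> l i) ->
  \sum_(i <- r) f i x @[x --> F] --> \sum_(i <- r) l i.
Proof.
move=> fl; elim: r => [|i r IHr].
  by rewrite big_nil; under eq_fun do rewrite big_nil; exact: cvg_cst.
by rewrite big_cons; under eq_fun do rewrite big_cons; exact: cvgD.
Qed.

Lemma cvg_dotp (T : Type) (F : set_system T) {FF : Filter F}
    (f g : T -> 'rV[R]_d) u v :
  f @ F --> u -> g @ F --> v -> dotp (f x) (g x) @[x --> F] --> dotp u v.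
Proof.
move=> fu gv; apply: cvg_sumr => i; apply: cvgM.
- exact: (cvg_comp _ _ fu (@coord_continuous R 1 d 0 i u)).
- exact: (cvg_comp _ _ gv (@coord_continuous R 1 d 0 i v)).
Qed.

(** The topology of row vectors comes from the sup norm, whereas projections are nonexpansive for
    the Euclidean norm; continuity of [dotp] bridges the two. *)
Lemma coord_nonexpansive_continuous (f : 'rV[R]_d -> R) :
  (forall u v, (f u - f v) ^+ 2 <= dotp (u - v) (u - v)) -> continuous f.
Proof.
move=> flip v; apply/(@cvgrPdist_lt _ R^o _ (nbhs v)) => e e0.
have : dotp (u - v) (u - v) @[u --> v] --> dotp (v - v) (v - v).
  have uv := @cvgB R 'rV[R]_d _ (nbhs v) _ id (cst v) v v cvg_id (cvg_cst v).
  exact: (cvg_dotp (uv _ _) (uv _ _)).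
rewrite subrr dotp0r => /cvgrPdist_lt.
move=> /(_ (e ^+ 2)); rewrite exprn_gt0// => /(_ isT); apply: filterS => u /=.
rewrite sub0r normrN ger0_norm ?dotpxx_ge0// => /(le_lt_trans (flip u v)).
by rewrite -(real_normK (num_real _)) distrC ltr_pXn2r// nnegrE ltW.
Qed.

End dotp_theory.

(** * Existence and variational inequality of the Euclidean projection *)

Section projection.
Context {R : realType} {d : nat}.
Variable C : set ('rV[R]_d * R).
Hypotheses (C0 : C !=set0) (cC : compact C).
Hypothesis convC : forall p q t, C p -> C q -> 0 <= t <= 1 ->
  C (p.1 + t *: (q.1 - p.1), p.2 + t * (q.2 - p.2)).
Implicit Types z p q : 'rV[R]_d * R.

Lemma eucl_proj_argmin z :
  argmin C (fun p => (eucl_norm2 (z - p))%:E) (eucl_proj C z).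
Proof.
apply: xgetPex.
pose f p := dotp (z.1 - p.1) (z.1 - p.1) + (z.2 - p.2) ^+ 2.
have cf : continuous f.
  move=> p; apply: cvgD.
    by apply: cvg_dotp; apply: cvgB; (exact: cvg_cst || exact: cvg_fst).
  by apply: cvgM; apply: cvgB; (exact: cvg_cst || exact: cvg_snd).
have [p /set_mem Cp pmin] :=
  compact_EVT_min C0 cC (continuous_subspaceT cf).
exists p; split => // q Cq; rewrite lee_fin !eucl_norm2E ler_wsqrtr//.
exact/pmin/mem_set.
Qed.

Lemma eucl_proj_in z : C (eucl_proj C z).
Proof. by have [] := eucl_proj_argmin z. Qed.

(** Moving from the projection p towards q by a fraction t cannot bring the point closer to z, so 2
    t a <= t^2 b on [0, 1], where a is the expression to bound and b = |q - p|^2. *)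
Lemma eucl_proj_variational z q : C q ->
  dotp (z.1 - (eucl_proj C z).1) (q.1 - (eucl_proj C z).1) +
  (z.2 - (eucl_proj C z).2) * (q.2 - (eucl_proj C z).2) <= 0.
Proof.
move=> Cq; have [Cp pmin] := eucl_proj_argmin z.
set p := eucl_proj C z in Cp pmin *.
set a := (X in X <= 0).
set b := dotp (q.1 - p.1) (q.1 - p.1) + (q.2 - p.2) ^+ 2.
have b0 : 0 <= b by rewrite addr_ge0 ?dotpxx_ge0 ?sqr_ge0.
have key t : 0 <= t <= 1 -> 2 * t * a <= t ^+ 2 * b.
  move=> /(convC Cp Cq)/pmin; rewrite lee_fin !eucl_norm2E.
  rewrite ler_sqrt ?addr_ge0 ?dotpxx_ge0 ?sqr_ge0//= !opprD !dotpE.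
  by rewrite /a /b !dotpE !(dotpC _ p.1) !(dotpC _ q.1); lra.
rewrite leNgt; apply/negP => a0.
have ab0 : 0 < a + b by rewrite ltr_pwDl.
(* The choice t = a / (a + b) is admissible even when b = 0, and contradicts [key] if a > 0. *)
have /key : 0 <= a / (a + b) <= 1.
  by rewrite divr_ge0 ?(ltW a0) ?(ltW ab0)//= ler_pdivrMr// mul1r lerDl.
rewrite expr2 -mulrA -mulrA mulrCA ler_pM2l ?divr_gt0//.
rewrite mulrAC ler_pdivlMr//.
have := mulr_gt0 a0 a0; have := mulr_ge0 (ltW a0) b0; lra.
Qed.

Lemma eucl_proj_id q : C q -> eucl_proj C q = q.
Proof.
move=> Cq; have := eucl_proj_variational q Cq.
move: (eucl_proj C q) => p; rewrite -expr2.
have /= := dotpxx_ge0 (q.1 - p.1); have := sqr_ge0 (q.2 - p.2) => h1 h2 h.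
have /dotpxx_eq0 e1 : dotp (q.1 - p.1) (q.1 - p.1) <= 0 by lra.
have /eqP : (q.2 - p.2) ^+ 2 = 0 by lra.
rewrite sqrf_eq0 subr_eq0 => /eqP e2; move/subr0_eq : e1 => e1.
by rewrite (surjective_pairing p) (surjective_pairing q) e1 e2.
Qed.

(** Expand |z - q|^2 around the projection p: the cross term 2 <z - p, p - q> is nonnegative by the
    variational inequality. *)
Lemma eucl_proj_le z q : C q ->
  dotp ((eucl_proj C z).1 - q.1) ((eucl_proj C z).1 - q.1) +
    ((eucl_proj C z).2 - q.2) ^+ 2
  <= dotp (z.1 - q.1) (z.1 - q.1) + (z.2 - q.2) ^+ 2.
Proof.
move=> Cq; have := eucl_proj_variational z Cq.
move: (eucl_proj C z) => p; have := dotpxx_ge0 (z.1 - p.1).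
rewrite !dotpE !(dotpC _ p.1) !(dotpC _ q.1).
have := sqr_ge0 (z.2 - p.2); lra.
Qed.

End projection.

(** * Projection onto a product Theta x A *)

Section projection_rectangle.
Context {R : realType} {d : nat}.
Variables (Theta : set 'rV[R]_d) (A : set R).
Hypotheses (C0 : Theta `*` A !=set0) (cC : compact (Theta `*` A)).
Hypothesis convC : forall p q t, (Theta `*` A) p -> (Theta `*` A) q ->
  0 <= t <= 1 -> (Theta `*` A) (p.1 + t *: (q.1 - p.1), p.2 + t * (q.2 - p.2)).
Let P := eucl_proj (Theta `*` A).

(* On a rectangle the two components of the projection decouple. *)
Lemma eucl_proj_fst_nonexpansive z z' :
  dotp ((P z).1 - (P z').1) ((P z).1 - (P z').1) <=
  dotp (z.1 - z'.1) (z.1 - z'.1).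
Proof.
have [T1 A1] := eucl_proj_in C0 cC z; have [T2 A2] := eucl_proj_in C0 cC z'.
(* Test points whose second component is already the projected one cancel the scalar terms and leave
   only the first components. *)
have := eucl_proj_variational C0 cC convC z (conj T2 A1 : _ ((P z').1, _)).
have := eucl_proj_variational C0 cC convC z' (conj T1 A2 : _ ((P z).1, _)).
rewrite -/P /= !subrr !mulr0 !addr0.
move: (P z).1 (P z').1 => p q.
have := dotpxx_ge0 ((z.1 - z'.1) - (p - q)).
rewrite !dotpE !(dotpC _ p) !(dotpC _ q) !(dotpC _ z'.1); lra.
Qed.

Lemma eucl_proj_snd_nonexpansive z z' :
  ((P z).2 - (P z').2) ^+ 2 <= (z.2 - z'.2) ^+ 2.
Proof.
have [T1 A1] := eucl_proj_in C0 cC z; have [T2 A2] := eucl_proj_in C0 cC z'.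
have := eucl_proj_variational C0 cC convC z (conj T1 A2 : _ (_, (P z').2)).
have := eucl_proj_variational C0 cC convC z' (conj T2 A1 : _ (_, (P z).2)).
rewrite -/P /= !subrr !dotp0r !add0r.
move: (P z).2 (P z').2 => p q.
have := sqr_ge0 ((z.2 - z'.2) - (p - q)); lra.
Qed.

(** By nonexpansiveness only the first component of the argument matters, so the second can be
    frozen at the arbitrary value 0. *)
Lemma eucl_proj_fst z : (P z).1 = (P (z.1, 0)).1.
Proof.
apply: subr0_eq; apply: dotpxx_eq0.
rewrite (le_trans (eucl_proj_fst_nonexpansive _ _))//= subrr.
by rewrite dotp0r.
Qed.

Lemma eucl_proj_snd z : (P z).2 = (P (0, z.2)).2.
Proof.
apply/eqP; rewrite -subr_eq0 -sqrf_eq0 eq_le sqr_ge0 andbT.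
by rewrite (le_trans (eucl_proj_snd_nonexpansive _ _))//= subrr expr0n.
Qed.

Lemma continuous_eucl_proj_fst i : continuous (fun u => (P (u, 0)).1 0 i).
Proof.
apply: coord_nonexpansive_continuous => u v.
have := sqr_coord_le_dotp ((P (u, 0)).1 - (P (v, 0)).1) i.
by rewrite !mxE => /le_trans; apply; exact: eucl_proj_fst_nonexpansive.
Qed.

Lemma continuous_eucl_proj_snd : continuous (fun a => (P (0, a)).2).
Proof.
move=> a; apply/cvgrPdist_lt => e e0; near=> b.
have := eucl_proj_snd_nonexpansive (0, a) (0, b).
rewrite -(real_normK (num_real _)) -[leRHS](real_normK (num_real _)).
rewrite ler_pXn2r ?nnegrE// => /le_lt_trans; apply => /=.
near: b; exact: cvgr_dist_lt.
Unshelve. all: by end_near. Qed.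

End projection_rectangle.

(** * Borel measurability of vector-valued maps *)

Section borel_rV_measurability.
Context {R : realType} {d : nat} {dT : measure_display} {T : measurableType dT}.

Lemma measurable_sumr D (I : Type) (s : seq I) (f : I -> T -> R) :
  (forall i, measurable_fun D (f i)) ->
  measurable_fun D (fun x => \sum_(i <- s) f i x).
Proof.
move=> mf; elim: s => [|i s IHs].
  by under eq_fun do rewrite big_nil; exact: measurable_cst.
by under eq_fun do rewrite big_cons; exact: measurable_funD.
Qed.

Lemma continuous_measurable_rV (f : 'rV[R]_d -> R) :
  continuous f -> measurable_fun setT (f : borel_rV R d -> R).
Proof.
move=> /continuousP cf; apply: (measurability _ (RGenOpens.measurableE R)).
move=> _ [_ [a [b ->]] <-]; rewrite setTI; apply: sub_sigma_algebra.
exact/cf/interval_open.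
Qed.

Lemma measurable_coord i :
  measurable_fun setT (fun u : borel_rV R d => (u : 'rV[R]_d) 0 i).
Proof. by apply: continuous_measurable_rV => u; exact: coord_continuous. Qed.

Lemma measurable_fun_coord D (f : T -> borel_rV R d) i :
  measurable_fun D f -> measurable_fun D (fun x => (f x : 'rV[R]_d) 0 i).
Proof. by move=> mf; exact: (measurableT_comp (measurable_coord i) mf). Qed.

(** Measurability passes through countable unions, hence balls with rational centres and radii 1 /
    (n + 1). *)
Lemma open_rV_bigcup_ball (U : set 'rV[R]_d) : open U ->
  U = \bigcup_(p in [set p : 'rV[rat]_d * nat |
        ball (map_mx ratr p.1 : 'rV[R]_d) p.2.+1%:R^-1 `<=` U])
      ball (map_mx ratr p.1 : 'rV[R]_d) p.2.+1%:R^-1.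
Proof.
move=> oU; rewrite eqEsubset; split => [u Uu|u [p pU up]]; last exact: pU.
have /nbhs_ballP[e /= e0 eU] : nbhs u U by exact: open_nbhs_nbhs.
(* A ball of radius below e / 2 that contains u stays inside the e-ball around u. *)
have [n ne] : exists n, n.+1%:R^-1 < e / 2.
  exists (Num.truncn (e / 2)^-1).
  by rewrite invf_plt ?posrE ?divr_gt0// truncnS_gt.
have n0 : 0 < n.+1%:R^-1 :> R by rewrite invr_gt0.
have q_ i : {q : rat | `|ratr q - u 0 i| < n.+1%:R^-1}.
  apply: cid; have : u 0 i - n.+1%:R^-1 < u 0 i + n.+1%:R^-1.
    by rewrite ltrBlDr -addrA ltrDl addr_gt0.
  move=> /rat_in_itvoo[q]; rewrite in_itv/= => qu; exists q.
  by rewrite ltr_distl.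
pose q := \row_i sval (q_ i) : 'rV[rat]_d.
have uq : ball (map_mx ratr q : 'rV[R]_d) n.+1%:R^-1 u.
  by split => // j i; rewrite ord1 !mxE; exact: svalP (q_ i).
exists (q, n) => //= v qv; apply: eU.
have ne2 : n.+1%:R^-1 + n.+1%:R^-1 <= e.
  by rewrite (splitr e) lerD// ltW.
apply: (le_ball ne2).
by apply: ball_triangle qv; exact: ball_sym.
Qed.

(** Balls of the sup norm are finite intersections of coordinate slabs, which reduces open sets to
    coordinates. *)
Lemma measurable_fun_rV (f : T -> borel_rV R d) :
  (forall i, measurable_fun setT (fun x => (f x : 'rV[R]_d) 0 i)) ->
  measurable_fun setT f.
Proof.
move=> mf;
apply: (@measurability _ _ T (borel_rV R d) setT f (@open 'rV[R]_d)) => //.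
move=> _ [U oU <-]; rewrite setTI (open_rV_bigcup_ball oU) preimage_bigcup.
rewrite bigcup_mkcond; apply: countable_bigcupT_measurable => // -[q n].
case: ifPn => // _.
have -> : f @^-1` ball (map_mx ratr q : 'rV[R]_d) n.+1%:R^-1 =
    \bigcap_(i in [set: 'I_d])
      ((fun x => (f x : 'rV[R]_d) 0 i) @^-1` ball (ratr (q 0 i) : R) n.+1%:R^-1).
  apply/seteqP; split => [x [_ qx] i _|x qx].
    by have := qx 0 i; rewrite mxE.
  split; first by rewrite invr_gt0.
  by move=> j i; rewrite ord1 mxE; exact: qx.
apply: fin_bigcap_measurable => // i _; rewrite -[X in measurable X]setTI.
by apply: mf => //; exact: measurable_ball.
Qed.

Lemma measurable_dotp D (f g : T -> borel_rV R d) :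
  measurable_fun D f -> measurable_fun D g ->
  measurable_fun D (fun x => dotp (f x) (g x)).
Proof.
move=> mf mg; apply: measurable_sumr => i.
by apply: measurable_funM; exact: measurable_fun_coord.
Qed.

Lemma measurable_funB_rV (f g : T -> borel_rV R d) :
  measurable_fun setT f -> measurable_fun setT g ->
  measurable_fun setT (fun x => f x - g x : borel_rV R d).
Proof.
move=> mf mg; apply: measurable_fun_rV => i; under eq_fun do rewrite !mxE.
by apply: measurable_funB; exact: measurable_fun_coord.
Qed.

Lemma measurable_funD_rV (f g : T -> borel_rV R d) :
  measurable_fun setT f -> measurable_fun setT g ->
  measurable_fun setT (fun x => f x + g x : borel_rV R d).
Proof.
move=> mf mg; apply: measurable_fun_rV => i; under eq_fun do rewrite !mxE.
by apply: measurable_funD; exact: measurable_fun_coord.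
Qed.

Lemma measurable_funZ_rV (f : T -> R) (g : T -> borel_rV R d) :
  measurable_fun setT f -> measurable_fun setT g ->
  measurable_fun setT (fun x => f x *: (g x : 'rV[R]_d) : borel_rV R d).
Proof.
move=> mf mg; apply: measurable_fun_rV => i; under eq_fun do rewrite !mxE.
by apply: measurable_funM => //; exact: measurable_fun_coord.
Qed.

End borel_rV_measurability.

(** * Joint measurability of the loss *)

Section convex_joint_measurability.
Context {R : realType} {d : nat} {dX : measure_display} {X : measurableType dX}.
Variables (Theta : set 'rV[R]_d) (L : X -> 'rV[R]_d -> R)
  (g : X -> 'rV[R]_d -> 'rV[R]_d).
Hypothesis convTheta : forall u v (t : R), Theta u -> Theta v -> 0 <= t <= 1 ->
  Theta (u + t *: (v - u)).
Hypothesis gL : forall x theta, Theta theta ->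
  subdifferential Theta (L x) theta (g x theta).

(* The Riemann sums of the directional subgradient along a segment: monotonicity
   of the subgradient makes the error telescope. *)
Lemma subgradient_riemann_sum x u v n (p : R -> R) : Theta u -> Theta v ->
  (forall t, p t = dotp (g x (u + t *: (v - u))) (v - u)) ->
  0 <= L x v - L x u - \sum_(i < n.+1) p (i%:R / n.+1%:R) / n.+1%:R
    <= (p 1 - p 0) / n.+1%:R.
Proof.
move=> Tu Tv pE; set m : R := n.+1%:R.
have m0 : 0 < m by rewrite ltr0n.
pose s i : R := i%:R / m; pose f i := L x (u + s i *: (v - u)).
have sS i : s i.+1 = s i + m^-1 by rewrite /s -natr1 mulrDl div1r.
have Ts i : (i <= n.+1)%N -> Theta (u + s i *: (v - u)).
  move=> im; apply: convTheta => //.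
  by rewrite /s divr_ge0 ?(ltW m0)//= ler_pdivrMr// mul1r ler_nat.
(* The subgradient inequalities at two neighbouring nodes, each tested at the other node, trap the
   increment of [f] between consecutive values of p / m. *)
have step i : (i < n.+1)%N ->
    0 <= f i.+1 - f i - p (s i) / m <= p (s i.+1) / m - p (s i) / m.
  have e1 : (u + s i.+1 *: (v - u)) - (u + s i *: (v - u)) = m^-1 *: (v - u).
    by rewrite opprD addrACA subrr add0r -scalerBl sS addrAC subrr add0r.
  move=> im; have := gL x (Ts _ (ltnW im)) (Ts _ im).
  have := gL x (Ts _ im) (Ts _ (ltnW im)).
  rewrite -[X in dotp _ X]opprB e1 dotpNr !dotpZr -!pE.
  rewrite -/(f i) -/(f i.+1) ![_ / m]mulrC.
  move: (f i) (f i.+1) (_ * p (s i)) (_ * p (s i.+1)) => a b a' b' h1 h2.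
  by apply/andP; split; lra.
have E1 : L x v - L x u = \sum_(i < n.+1) (f i.+1 - f i).
  rewrite -(big_mkord xpredT (fun i => f i.+1 - f i)) telescope_sumr//.
  rewrite /f /s mul0r scale0r addr0 divff ?gt_eqF// scale1r.
  by rewrite (addrC u) subrK.
have E2 : (p 1 - p 0) / m =
    \sum_(i < n.+1) (p (s i.+1) / m - p (s i) / m).
  rewrite -(big_mkord xpredT (fun i => p (s i.+1) / m - p (s i) / m)).
  rewrite (telescope_sumr (fun i => p (s i) / m))//.
  by rewrite /s mul0r divff ?gt_eqF// mulrBl.
rewrite E1 E2 -sumrB; apply/andP; split.
  by apply: sumr_ge0 => i _; have /andP[] := step i (ltn_ord i).
by apply: ler_sum => i _; have /andP[] := step i (ltn_ord i).
Qed.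

Variables (r : 'rV[R]_d -> 'rV[R]_d) (theta0 : 'rV[R]_d).
Hypotheses (rTheta : forall u, Theta (r u)) (Theta0 : Theta theta0).
Hypothesis clTheta : closed Theta.
Hypothesis mr : measurable_fun setT (r : borel_rV R d -> borel_rV R d).
Hypothesis mg : jointly_measurable Theta g.
Hypothesis mL : measurable_fun setT (L ^~ theta0).

(** [mg] concerns only the pairs with second component in Theta, a Borel set because Theta is
    closed; hence the requirement that [h] take values in Theta. *)
Lemma measurable_jointly_comp (dT : measure_display) (T : measurableType dT)
    (f : T -> X) (h : T -> borel_rV R d) :
  (forall t, Theta (h t)) -> measurable_fun setT f -> measurable_fun setT h ->
  measurable_fun setT (fun t => g (f t) (h t) : borel_rV R d).
Proof.
move=> Th mf mh.
apply: (@measurable_comp _ _ _ T (X * borel_rV R d)%type (borel_rV R d)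
  _ (fun p => g p.1 p.2) setT (fun t => (f t, h t)) _ _ mg).
- rewrite (_ : mkset _ = snd @^-1` Theta)// -[X in measurable X]setTI.
  apply: measurable_snd => //; rewrite -(setCK Theta); apply: measurableC.
  by apply: sub_sigma_algebra; exact: closed_openC.
- by move=> _ [t _ <-]; exact: Th.
- exact: measurable_fun_pair.
Qed.

(** The segment starts at the fixed point [theta0], where L is measurable in x, and ends at [r p.2];
    the map [r] into Theta makes the function total. *)
Lemma measurable_jointly_convex :
  measurable_fun setT (fun p : X * borel_rV R d => L p.1 (r p.2)).
Proof.
pose v (p : X * borel_rV R d) : 'rV[R]_d := r p.2 - theta0.
pose q t p : R := dotp (g p.1 (theta0 + t *: v p)) (v p).
have mr2 : measurable_fun setT
    (fun p : X * borel_rV R d => r p.2 : borel_rV R d).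
  exact: (measurableT_comp mr measurable_snd).
have mv : measurable_fun setT (v : _ -> borel_rV R d).
  by apply: measurable_funB_rV => //; exact: measurable_cst.
have mq t : 0 <= t <= 1 -> measurable_fun setT (q t).
  move=> t01; apply: measurable_dotp => //.
  apply: (measurable_jointly_comp (f := fst)) => //.
    by move=> p; exact: convTheta.
  apply: measurable_funD_rV; first exact: measurable_cst.
  by apply: measurable_funZ_rV => //; exact: measurable_cst.
pose h (n : nat) (p : X * borel_rV R d) : R :=
  L p.1 theta0 + \sum_(i < n.+1) q (i%:R / n.+1%:R) p / n.+1%:R.
apply: (@measurable_fun_cvg _ _ _ _ h) => [n|p _].
  apply: measurable_funD; first exact: (measurableT_comp mL measurable_fst).
  apply: measurable_sumr => i; apply: measurable_funM => //.
  apply: mq; rewrite divr_ge0//= ler_pdivrMr// mul1r ler_nat.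
  exact/ltnW/ltn_ord.
apply/cvgrPdist_le => e e0.
(* The error of the Riemann sum is at most (q 1 - q 0) / (n + 1). *)
have /cvgrPdist_le/(_ e e0) :
    (q 1 p - q 0 p) * n.+1%:R^-1 @[n --> \oo] --> (0 : R).
  rewrite -[X in _ --> X](mulr0 (q 1 p - q 0 p)).
  by apply: cvgM; [exact: cvg_cst|exact: cvg_harmonic].
apply: filterS => n; rewrite sub0r normrN => qn.
have /= /andP[h0 h1] :=
  @subgradient_riemann_sum p.1 _ _ n (q ^~ p) Theta0 (rTheta p.2) (fun=> erefl).
rewrite opprD addrA ger0_norm//; apply: (le_trans h1).
exact: (le_trans (ler_norm _) qn).
Qed.

End convex_joint_measurability.

(** * Scalar inequalities for the integrand of G_rho *)

Section softplus.
Context {R : realType}.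
Implicit Types u s t l a rho : R.

(** This is the tangent line at t = 0 of a convex function. Factoring out 1 + u turns it into e^(w
    t) <= 1 - w + w e^t with w = u / (1 + u). *)
Lemma ln1D_tangent u t : 0 <= u ->
  ln (1 + u) + u / (1 + u) * t <= ln (1 + u * expR t).
Proof.
move=> u0; have u1 : 0 < 1 + u by rewrite ltr_pwDl.
set w := u / (1 + u); set c := w * t.
have w0 : 0 <= w by rewrite divr_ge0// ltW.
have w1 : w <= 1 by rewrite ler_pdivrMr// mul1r lerDr.
have -> : 1 + u * expR t = (1 + u) * (1 - w + w * expR t).
  by rewrite /w; field; rewrite gt_eqF.
(* Average the tangent line of exp at c = w t over the points 0 and t, with weights 1 - w and w. *)
have key : expR c <= 1 - w + w * expR t.
  have h1 : expR c * (1 - c) <= 1.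
    rewrite -[leRHS]expR0 -(subrr c) expRD ler_pM2l ?expR_gt0//.
    exact: expR_ge1Dx.
  have h2 : expR c * (1 + (t - c)) <= expR t.
    rewrite -[in leRHS](subrKC c t) expRD ler_pM2l ?expR_gt0//.
    exact: expR_ge1Dx.
  have -> : expR c =
      (1 - w) * (expR c * (1 - c)) + w * (expR c * (1 + (t - c))).
    by rewrite /c; ring.
  apply: lerD; last exact: ler_wpM2l.
  by rewrite -[leRHS]mulr1; apply: ler_wpM2l => //; rewrite subr_ge0.
have k0 := lt_le_trans (expR_gt0 c) key.
by rewrite lnM ?posrE// lerD2l -[leLHS]expRK ler_ln ?posrE// expR_gt0.
Qed.

(** From -ln (1 + u) = ln (1 - u / (1 + u)) and ln (1 + x) <= x. *)
Lemma ln1D_ge u : 0 <= u -> u / (1 + u) <= ln (1 + u).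
Proof.
move=> u0; have u1 : 0 < 1 + u by rewrite ltr_pwDl.
rewrite -lerN2 -lnV ?posrE//.
have E : (1 + u)^-1 = 1 + - (u / (1 + u)) by field; rewrite gt_eqF.
rewrite [X in ln X]E; apply: le_ln1Dx; rewrite ltrN2 ltr_pdivrMr// mul1r.
by rewrite ltrDr.
Qed.

Lemma ln1D_le u : 0 <= u -> ln (1 + u) <= u.
Proof. by move=> u0; apply: le_ln1Dx; rewrite (lt_le_trans _ u0)// ltrN10. Qed.

(* Expanding the convex function [s |-> ln (1 + u e^s)] at 0, and at 1 when
   [s >= 1]. *)
Lemma ln1DexpR_ge u s : 0 <= u ->
  [/\ s <= 0 -> (1 + s) * u - u ^+ 2 <= ln (1 + u * expR s),
      0 <= s <= 1 -> (1 + s) * u - (1 + s) * u ^+ 2 <= ln (1 + u * expR s) &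
      1 <= s -> (2 + (s - 1) * (3 / 2)) * u - (1 + s) * u ^+ 2
                <= ln (1 + u * expR s)].
Proof.
move=> u0; have u1 : 0 < 1 + u by rewrite ltr_pwDl.
have lo : u - u ^+ 2 <= u / (1 + u).
  rewrite ler_pdivlMr//; have : 0 <= u ^+ 3 by rewrite exprn_ge0.
  rewrite !exprS expr0; lra.
have up : u / (1 + u) <= u by rewrite ler_pdivrMr// ler_peMr// lerDl.
have h := ln1D_ge u0.
split=> [s0|/andP[s0 s1]|s1].
- have := ln1D_tangent s u0.
  have : u * s <= u / (1 + u) * s by rewrite ler_wnM2r.
  move: lo h; move: (u / (1 + u)) (ln _) (ln _) => w x y.
  lra.
- have := ln1D_tangent s u0.
  have : (u - u ^+ 2) * s <= u / (1 + u) * s by rewrite ler_wpM2r.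
  move: lo h; move: (u / (1 + u)) (ln _) (ln _) => w x y; lra.
have e1 : 2 <= expR 1 :> R by rewrite (le_trans _ (expR_ge1Dx 1)).
set v := u * expR 1; have v0 : 0 <= v by rewrite mulr_ge0 ?expR_ge0.
have v1 : 0 < 1 + v by rewrite ltr_pwDl.
have := ln1D_tangent (s - 1) v0.
have -> : v * expR (s - 1) = u * expR s by rewrite -mulrA -expRD subrKC.
have := ln1D_tangent 1 u0; rewrite -/v mulr1.
(* Since e >= 2, v may be replaced by 2 u. The gap is then u (2 u - 1)^2 / (2 (1 + 2 u)): the
   constant 3/2 produces a perfect square. *)
have : u * (3 / 2) - u ^+ 2 <= v / (1 + v).
  have uv : 2 * u <= v by rewrite mulrC ler_wpM2l.
  have u2 : 0 < 1 + 2 * u by rewrite ltr_pwDl// mulr_ge0.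
  apply: (@le_trans _ _ (2 * u / (1 + 2 * u))).
    rewrite ler_pdivlMr//.
    have : 0 <= u * (2 * u - 1) ^+ 2 by rewrite mulr_ge0// sqr_ge0.
    rewrite !exprS expr0; lra.
  rewrite ler_pdivrMr// mulrAC ler_pdivlMr//; lra.
move=> /(ler_wpM2r (_ : 0 <= s - 1)); rewrite subr_ge0 => /(_ s1).
move: lo h.
move: (u / (1 + u)) (v / (1 + v)) (ln _) (ln _) (ln _) => w w' x y z.
lra.
Qed.

(** Integrand of G_rho, with the loss value as the scalar argument l. *)
Definition Gterm rho l a := a - 1 + rho^-1 * ln (1 + rho * expR (l - a)).

(** The factor [s] of [g_rho]. For rho > 0 it is the derivative of [Gterm] in l, and 1 - [weight] is
    the derivative in a. *)
Definition weight rho l a := rho^-1 * sigmoid (l - a + ln rho).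

Lemma weightE rho l a : 0 < rho ->
  weight rho l a = rho^-1 * (rho * expR (l - a) / (1 + rho * expR (l - a))).
Proof. by move=> r0; rewrite /weight /sigmoid expRD lnK// [_ * rho]mulrC. Qed.

Lemma weight_ge0 rho l a : 0 < rho -> 0 <= weight rho l a.
Proof.
move=> r0; rewrite weightE// mulr_ge0 ?invr_ge0 ?(ltW r0)//.
by rewrite divr_ge0 ?addr_ge0 ?mulr_ge0 ?expR_ge0 ?(ltW r0).
Qed.

Lemma weight_le rho l a : 0 < rho -> weight rho l a <= rho^-1.
Proof.
move=> r0; have e0 : 0 <= rho * expR (l - a) by rewrite mulr_ge0 ?expR_ge0 ?ltW.
rewrite weightE// -[leRHS]mulr1 ler_pM2l ?invr_gt0//.
by rewrite ler_pdivrMr ?mul1r ?lerDr ?ltr_pwDl.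
Qed.

(** Tangent inequality at u = rho e^(l - a) with displacement (l' - a') - (l - a); it expresses
    joint convexity in (l, a). *)
Lemma Gterm_subgradient rho l a l' a' : 0 < rho ->
  Gterm rho l a + weight rho l a * (l' - l) + (1 - weight rho l a) * (a' - a)
  <= Gterm rho l' a'.
Proof.
move=> r0; have e0 : 0 <= rho * expR (l - a) by rewrite mulr_ge0 ?expR_ge0 ?ltW.
have := ln1D_tangent (l' - a' - (l - a)) e0.
have -> : rho * expR (l - a) * expR (l' - a' - (l - a)) = rho * expR (l' - a').
  by rewrite -mulrA -expRD subrKC.
rewrite -(@ler_pM2l _ rho^-1) ?invr_gt0// mulrDr mulrA -weightE// /Gterm.
move: (weight _ _ _) (_ * ln _) (_ * ln _) => w x y; lra.
Qed.

(** Makes the integrand nonnegative after a constant shift, so that Tonelli applies later. *)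
Lemma Gterm_ge rho l a : 0 < rho -> a - 1 <= Gterm rho l a.
Proof.
move=> r0; rewrite lerDl mulr_ge0 ?invr_ge0 ?(ltW r0)// ln_ge0// lerDl.
by rewrite mulr_ge0 ?expR_ge0 ?ltW.
Qed.

Lemma Gterm_le rho l a : 0 < rho -> Gterm rho l a <= a - 1 + expR (l - a).
Proof.
move=> r0; rewrite lerD2l ler_pdivrMl//.
by apply: ln1D_le; rewrite mulr_ge0 ?expR_ge0 ?ltW.
Qed.

End softplus.

Lemma measurable_Gterm (R : realType) (dT : measure_display)
    (T : measurableType dT) (rho : R) (f h : T -> R) :
  measurable_fun setT f -> measurable_fun setT h ->
  measurable_fun setT (fun t => Gterm rho (f t) (h t)).
Proof.
move=> mf mh; apply: measurable_funD; first exact: measurable_funD.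
apply: measurable_funM => //; apply: measurableT_comp => //.
apply: measurable_funD => //; apply: measurable_funM => //.
by apply: measurableT_comp => //; exact: measurable_funB.
Qed.

Lemma measurable_weight (R : realType) (dT : measure_display)
    (T : measurableType dT) (rho : R) (f h : T -> R) :
  measurable_fun setT f -> measurable_fun setT h ->
  measurable_fun setT (fun t => weight rho (f t) (h t)).
Proof.
move=> mf mh.
(* Written as a single exponential, the quotient needs only measurability of sums, ln and exp. *)
have sigmoidE s : sigmoid s = expR (s - ln (1 + expR s)) :> R.
  by rewrite expRD expRN lnK// posrE addr_gt0 ?expR_gt0.
under eq_fun do rewrite /weight sigmoidE.
have ms : measurable_fun setT (fun t => f t - h t + ln rho).
  by apply: measurable_funD => //; exact: measurable_funB.
apply: measurable_funM => //; apply: measurableT_comp => //.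
apply: measurable_funB => //; apply: measurableT_comp => //.
by apply: measurable_funD => //; exact: measurableT_comp.
Qed.

(** The weight w lies in [0, 1/rho], and rho <= 1 gives |1 - w| <= 1/rho as well. *)
Lemma sqr_g_rho_le (R : realType) (d : nat) (X : Type) (L : X -> 'rV[R]_d -> R)
    (g : X -> 'rV[R]_d -> 'rV[R]_d) (rho : R) x z : 0 < rho <= 1 ->
  dotp (g_rho L g rho x z).1 (g_rho L g rho x z).1 + (g_rho L g rho x z).2 ^+ 2
  <= (dotp (g x z.1) (g x z.1) + 1) / rho ^+ 2.
Proof.
move=> /andP[r0 r1].
rewrite /g_rho /= -/(weight rho (L x z.1) z.2) dotpZl dotpZr.
have w0 := weight_ge0 (L x z.1) z.2 r0; have w1 := weight_le (L x z.1) z.2 r0.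
have := dotpxx_ge0 (g x z.1).
have i1 : 1 <= rho^-1 by rewrite invf_ge1.
move: (weight _ _ _) (dotp _ _) w0 w1 => w D w0 w1 D0.
rewrite -exprVn; move: (rho^-1) i1 w1 => i i1 w1.
have wi : w ^+ 2 <= i ^+ 2 by rewrite ler_pXn2r ?nnegrE// (le_trans w0).
have wi' : (1 - w) ^+ 2 <= i ^+ 2 by nra.
by rewrite mulrDl mul1r mulrA -expr2 lerD// mulrC ler_wpM2l.
Qed.

(** * Independence of a sample from the past *)

Section independence.
Local Open Scope ereal_scope.
Context {dO dX : measure_display} {Omega : measurableType dO}
  {X : measurableType dX} {R : realType} (Pr : probability Omega R).
Variable xi : nat -> {RV Pr >-> X}.

(** Cylinders over the first k samples: a pi-system generating their sigma-algebra, in the product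
    form for which independence is stated. *)
Definition past (k : nat) : set (set Omega) :=
  [set B | exists A : nat -> set X, (forall j, measurable (A j)) /\
    B = \bigcap_(j in `I_k) (xi j @^-1` A j)].

Notation past_algebra k := (g_sigma_algebraType (past k)).

Lemma measurable_preimage_xi j (A : set X) :
  measurable A -> measurable (xi j @^-1` A).
Proof.
by move=> mA; rewrite -[X in measurable X]setTI; exact: measurable_funP.
Qed.

Lemma past_measurable k : past k `<=` measurable.
Proof.
move=> _ [A [mA ->]]; apply: fin_bigcap_measurable => [|j _].
  exact: finite_II.
exact: measurable_preimage_xi.
Qed.

Lemma g_past_measurable k : <<s past k >> `<=` measurable.
Proof.
apply: smallest_sub; first exact: sigma_algebra_measurable.
exact: past_measurable.
Qed.

Lemma past_mono k : past k `<=` past k.+1.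
Proof.
move=> _ [A [mA ->]]; exists (fun j => if (j < k)%N then A j else setT); split.
  by move=> j; case: ifP.
apply/seteqP; split => [w Aw j _|w Aw j jk] /=.
  by case: ifP => // jk; exact: Aw.
by have := Aw j (ltnW jk); rewrite /= (jk : (j < k)%N).
Qed.

Lemma past_setI k : setI_closed (past k).
Proof.
move=> _ _ [A [mA ->]] [B [mB ->]]; exists (fun j => A j `&` B j); split.
  by move=> j; exact: measurableI.
by rewrite -bigcapI; apply: eq_bigcapr => j _; rewrite preimage_setI.
Qed.

Lemma pastT k : past k setT.
Proof.
by exists (fun=> setT); split=> //; apply/seteqP; split.
Qed.

Lemma measurable_xi_past j k :
  (j < k)%N -> measurable_fun setT (xi j : past_algebra k -> X).
Proof.
move=> jk _ A mA; rewrite setTI; apply: sub_sigma_algebra.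
exists (fun i => if i == j then A else setT); split => [i|]; first by case: ifP.
apply/seteqP; split => [w Aw i _|w]; last first.
  by move=> /(_ j jk); rewrite /= eqxx.
by rewrite /=; case: eqVneq => [->|].
Qed.

Lemma measurable_past_mono k (dS : measure_display) (S : measurableType dS)
    (Z : Omega -> S) :
  measurable_fun setT (Z : past_algebra k -> S) ->
  measurable_fun setT (Z : past_algebra k.+1 -> S).
Proof.
move=> mZ _ A mA; have := mZ measurableT A mA.
rewrite !setTI; apply: sub_sigma_algebra2 => //; exact: past_mono.
Qed.

Lemma measurable_past_sub k (dS : measure_display) (S : measurableType dS)
    (Z : Omega -> S) :
  measurable_fun setT (Z : past_algebra k -> S) -> measurable_fun setT Z.
Proof.
by move=> mZ _ A mA; have := mZ measurableT A mA; exact: g_past_measurable.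
Qed.

Hypothesis indep : mutually_independent xi.

Lemma Pr_bigcap_xi k (A : nat -> set X) : (forall j, measurable (A j)) ->
  Pr (\bigcap_(j in `I_k) (xi j @^-1` A j)) =
  \prod_(0 <= j < k) Pr (xi j @^-1` A j).
Proof.
move=> mA; have := indep [fset j | j in iota 0 k]%fset mA.
have -> : [set` [fset j | j in iota 0 k]%fset] = `I_k.
  by apply/seteqP; split => j /=; rewrite inE/= mem_iota.
move=> ->; apply: perm_big; apply: uniq_perm; rewrite ?fset_uniq ?iota_uniq//.
by move=> j; rewrite inE/= /index_iota subn0.
Qed.

(** For fixed A both sides are finite measures in B, a restriction and a multiple of [Pr]. They
    agree on the pi-system of cylinders, hence on what it generates. *)
Lemma past_indep k (A : set X) (B : set Omega) : measurable A ->
  <<s past k >> B -> Pr (xi k @^-1` A `&` B) = Pr (xi k @^-1` A) * Pr B.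
Proof.
move=> mA sB; have mxA := measurable_preimage_xi k mA.
pose r : {nonneg R} := NngNum (fine_ge0 (measure_ge0 Pr (xi k @^-1` A))).
have rE : (r%:num)%:E = Pr (xi k @^-1` A) by rewrite /= fineK// fin_num_measure.
rewrite setIC -[LHS]/(mrestr Pr mxA B).
have -> : Pr (xi k @^-1` A) * Pr B = mscale r Pr B.
  by rewrite /mscale rE.
apply: (@g_sigma_algebra_measure_unique _ _ _ (past k) _ (fun=> setT)) => //.
- exact: past_measurable.
- by move=> _; exact: pastT.
- by apply/seteqP; split => // w _; exists 0%N.
- exact: past_setI.
- move=> _ [C [mC ->]]; rewrite -[RHS]/((r%:num)%:E * Pr _) rE.
  rewrite -[LHS]/(Pr (_ `&` _)).
  (* Putting A at index k merges the two events into one cylinder of length k + 1. *)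
  pose D j := if (j < k)%N then C j else A.
  have -> : \bigcap_(j in `I_k) (xi j @^-1` C j) `&` xi k @^-1` A =
      \bigcap_(j in `I_k.+1) (xi j @^-1` D j).
    rewrite /D; apply/seteqP; split => [w [Cw Aw] j|w Dw].
      move=> jk /=; case: ifP => [|/negbT]; first exact: Cw.
      rewrite -leqNgt => kj; suff -> : j = k by [].
      by apply/eqP; rewrite eqn_leq kj andbT.
    split; last by have := Dw k (ltnSn k); rewrite /= ltnn.
    by move=> j jk; have := Dw j (ltnW jk); rewrite /= (jk : (j < k)%N).
  rewrite Pr_bigcap_xi; last by move=> j; rewrite /D; case: ifP.
  have -> : A = D k by rewrite /D ltnn.
  rewrite big_nat_recr//= Pr_bigcap_xi// muleC; congr (_ * _).
  by apply: eq_big_nat => j /andP[_ jk]; rewrite /D jk.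
- move=> _; apply: le_lt_trans (ltry 1%R); rewrite -[X in X <= _]/(Pr (_ `&` _)).
  by apply: probability_le1; exact: measurableI.
Qed.

Variable mu : probability X R.
Hypothesis law : forall k (A : set X), measurable A ->
  distribution Pr (xi k) A = mu A.

(** Stands in for conditioning on the past: the joint law of sample k and Z is a product, and
    Tonelli integrates the sample first. *)
Lemma integral_indep k (dS : measure_display) (S : measurableType dS)
    (Z : Omega -> S) (f : X * S -> \bar R) :
  measurable_fun setT (Z : past_algebra k -> S) ->
  measurable_fun setT f -> (forall p, 0 <= f p) ->
  \int[Pr]_w f (xi k w, Z w) = \int[Pr]_w \int[mu]_x f (x, Z w).
Proof.
move=> mZ mf f0; have mZ' := measurable_past_sub mZ.
pose Z' : {RV Pr >-> S} := HB.pack Z (isMeasurableFun.Build _ _ _ _ _ mZ').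
have mY : measurable_fun setT (fun w => (xi k w, Z w)).
  by apply: measurable_fun_pair => //; exact: measurable_funP.
pose Y : {RV Pr >-> (X * S)%type} :=
  HB.pack (fun w => (xi k w, Z w)) (isMeasurableFun.Build _ _ _ _ _ mY).
have prodE C : measurable C ->
    (mu \x distribution Pr Z') C = distribution Pr Y C.
  apply: product_measure_unique => A B mA mB.
  have sB : <<s past k >> (Z @^-1` B).
    by have := mZ measurableT B mB; rewrite setTI.
  transitivity (Pr (xi k @^-1` A) * Pr (Z @^-1` B)); first exact: past_indep.
  by congr (_ * _); exact: law.
transitivity (\int[distribution Pr Y]_p f p).
  by rewrite ge0_integral_pushforward// => p _; exact: f0.
rewrite (eq_measure_integral (mu \x distribution Pr Z')); last first.
  by move=> C mC _; exact/esym/prodE.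
rewrite fubini_tonelli2//= ge0_integral_pushforward//.
  by apply: measurable_fun_fubini_tonelli_G.
by move=> s _; apply: integral_ge0 => x _; exact: f0.
Qed.

End independence.
Notation past_algebra xi k := (g_sigma_algebraType (past xi k)).

(* The quadratic lower bound is tight enough that integrating it against
   [u = rho * Y] with [E Y = 1] and [k = rho * E Y^2] loses at most [2 * k]. *)
Lemma ln1DexpR_ge_quadratic (R : realType) (s : R) : exists A B : R,
  (forall u, 0 <= u -> A * u - B * u ^+ 2 <= ln (1 + u * expR s)) /\
  (forall k, 0 <= k <= 1 / 2 -> 1 + s - 2 * k <= A - B * k).
Proof.
case: (leP s 0) => [s0|s0].
  exists (1 + s), 1; split => [u u0|k k01]; last by lra.
  by rewrite mul1r; have [+ _ _] := ln1DexpR_ge s u0; exact.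
case: (leP s 1) => [s1|/ltW s1].
  exists (1 + s), (1 + s); split => [u u0|k /andP[k0 k1]]; last by nra.
  by have [_ + _] := ln1DexpR_ge s u0; apply; rewrite (ltW s0).
(* The gap here is (s - 1) (1/2 - k), which is where k <= 1/2 enters; for 0 <= s <= 1 it was k (1 -
   s). *)
exists (2 + (s - 1) * (3 / 2)), (1 + s); split => [u u0|k /andP[k0 k1]].
  by have [_ _ +] := ln1DexpR_ge s u0; exact.
nra.
Qed.

(** * Moments of e^phi and comparison of G_rho with F *)

Section logint_moments.
Context {R : realType} {dX : measure_display} {X : measurableType dX}.
Variables (mu : probability X R) (phi : X -> R).
Hypothesis mphi : measurable_fun setT phi.
Hypothesis phi2 : (logint mu (fun x => 2 * phi x)%R < +oo)%E.

Let y x := expR (phi x).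

Let my : measurable_fun setT y.
Proof. exact: measurableT_comp. Qed.

Let my2 : measurable_fun setT (fun x => y x ^+ 2).
Proof. exact: measurable_funX. Qed.

Let y_ge0 x : 0 <= y x. Proof. exact: expR_ge0. Qed.

Let y2E x : expR (2 * phi x) = y x ^+ 2.
Proof. by rewrite expRM_natl. Qed.

Let int_y2 : (\int[mu]_x (y x ^+ 2)%:E < +oo)%E.
Proof.
move: phi2; rewrite /logint; under eq_integral do rewrite y2E.
by case: integral => [r _||]; rewrite ?ltry.
Qed.

Let integrable_y2 : mu.-integrable setT (fun x => (y x ^+ 2)%:E).
Proof.
apply/integrableP; split; first exact/measurable_EFinP.
by under eq_integral do rewrite abse_EFin ger0_norm ?sqr_ge0//.
Qed.

Let integrable_cst (K : R) : mu.-integrable setT (cst K%:E).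
Proof. by apply: finite_measure_integrable_cst. Qed.

(** Dominated by 1 + y^2. *)
Let integrable_y : mu.-integrable setT (fun x => (y x)%:E).
Proof.
apply: (@le_integrable _ _ _ mu _ measurableT _
  (fun x => (1%:E + (y x ^+ 2)%:E)%E)).
- exact/measurable_EFinP.
- move=> x _; rewrite -EFinD !abse_EFin lee_fin !ger0_norm ?addr_ge0 ?sqr_ge0//.
  by have := sqr_ge0 (y x - 1); have := y_ge0 x; nra.
- by apply: integrableD => //; exact: integrable_cst.
Qed.

(** Used for n = 1 and n = 2, where the integral is finite and [fine] loses nothing. *)
Definition moment n := fine (\int[mu]_x (expR (phi x) ^+ n)%:E)%E.

Let moment1E : (\int[mu]_x (y x)%:E = (moment 1)%:E)%E.
Proof.
rewrite /moment; under [in RHS]eq_integral do rewrite expr1.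
by rewrite fineK//; exact: integrable_fin_num.
Qed.

Let moment2E : (\int[mu]_x (y x ^+ 2)%:E = (moment 2)%:E)%E.
Proof. by rewrite fineK//; exact: integrable_fin_num. Qed.

Lemma integrable_quadratic (K A B : R) :
  mu.-integrable setT
    (fun x => (K + A * expR (phi x) + B * expR (phi x) ^+ 2)%:E).
Proof.
under eq_fun do rewrite 2!EFinD (EFinM A) (EFinM B).
apply: integrableD => //; last exact: integrableZl.
by apply: integrableD => //; [exact: integrable_cst|exact: integrableZl].
Qed.

Lemma integral_quadratic (K A B : R) :
  (\int[mu]_x (K + A * expR (phi x) + B * expR (phi x) ^+ 2)%:E =
   (K + A * moment 1 + B * moment 2)%:E)%E.
Proof.
under eq_integral do rewrite 2!EFinD (EFinM A) (EFinM B).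
have iA : mu.-integrable setT (fun x => A%:E * (y x)%:E)%E.
  exact: integrableZl.
have iB : mu.-integrable setT (fun x => B%:E * (y x ^+ 2)%:E)%E.
  exact: integrableZl.
rewrite (integralD measurableT (integrableD measurableT (integrable_cst K) iA) iB).
rewrite (integralD measurableT (integrable_cst K) iA).
have -> : (\int[mu]_x (cst K%:E) x = K%:E)%E.
  by rewrite integral_cst// -[X in (_ * X)%E]/(mu setT) probability_setT mule1.
rewrite !integralZl// moment1E moment2E.
by rewrite -!EFinM -!EFinD.
Qed.

(** If the positive function e^phi had integral 0, the whole space would be negligible, against its
    mass 1. *)
Lemma moment1_gt0 : 0 < moment 1.
Proof.
have m1 : 0 <= moment 1.
  by apply: fine_ge0; apply: integral_ge0 => x _; rewrite lee_fin expr1.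
rewrite lt_neqAle m1 andbT; apply/eqP => m0.
have : (\int[mu]_x `|(y x)%:E| = 0)%E.
  rewrite -[RHS]/(0%:E) m0 -moment1E; apply: eq_integral => x _.
  by rewrite gee0_abs// lee_fin.
move/(ae_eq_integral_abs mu measurableT).
have mEy : measurable_fun setT (EFin \o y) by exact/measurable_EFinP.
move=> /(_ mEy) y0.
have : mu.-negligible setT.
  apply: negligibleS y0 => x _ /= /(_ I) [] /eqP.
  by rewrite gt_eqF// expR_gt0.
move/(negligibleP mu measurableT) => mu0; have /eqP := probability_setT mu.
by rewrite (mu0 : mu setT = 0%E) eq_sym onee_eq0.
Qed.

Lemma logintE : logint mu phi = (ln (moment 1))%:E.
Proof. by rewrite /logint moment1E lne_EFin// moment1_gt0. Qed.

(** Integrate (E Y - Y)^2 >= 0 for Y = e^phi. *)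
Lemma moment2_ge : moment 1 ^+ 2 <= moment 2.
Proof.
have : (0 <= \int[mu]_x (moment 1 ^+ 2 + (- 2 * moment 1) * expR (phi x) +
    1 * expR (phi x) ^+ 2)%:E)%E.
  apply: integral_ge0 => x _; rewrite lee_fin.
  have := sqr_ge0 (moment 1 - expR (phi x)); lra.
rewrite integral_quadratic lee_fin; lra.
Qed.

Lemma kappaE : kappa mu phi = (moment 2 / moment 1 ^+ 2)%:E.
Proof.
have m1 := moment1_gt0.
have m2 : 0 < moment 2 by rewrite (lt_le_trans _ moment2_ge) ?exprn_gt0.
rewrite /kappa logintE /logint; under eq_integral do rewrite y2E.
rewrite moment2E lne_EFin//= expRD lnK// expRN mulr_natl.
by rewrite -lnXn// lnK// posrE exprn_gt0.
Qed.

Variable rho : R.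
Hypothesis rho0 : 0 < rho.

Let measurable_GtermD a c :
  measurable_fun setT (fun x => (Gterm rho (phi x) a + c)%:E).
Proof.
apply/measurable_EFinP; apply: measurable_funD => //.
exact: measurable_Gterm.
Qed.

(** At a = F the upper bound a - 1 + e^(phi - a) has mean a, because E e^(phi - F) = 1. *)
Lemma integral_Gterm_le c : 0 <= ln (moment 1) - 1 + c ->
  (\int[mu]_x (Gterm rho (phi x) (ln (moment 1)) + c)%:E <=
   logint mu phi + c%:E)%E.
Proof.
move=> c0; set a := ln _ in c0 *; have m1 := moment1_gt0.
rewrite logintE -EFinD.
have <- : (\int[mu]_x (a - 1 + c + (moment 1)^-1 * expR (phi x) +
    0 * expR (phi x) ^+ 2)%:E = (a + c)%:E)%E.
  rewrite integral_quadratic; congr EFin.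
  by field; rewrite gt_eqF.
apply: ge0_le_integral => //.
- by move=> x _; rewrite lee_fin; have := Gterm_ge (phi x) a rho0; lra.
- exact: measurable_int (integrable_quadratic _ _ _).
- move=> x _; rewrite lee_fin; have := Gterm_le (phi x) a rho0.
  by rewrite expRD expRN lnK// mul0r (mulrC _^-1); lra.
Qed.

(** With Y = e^phi / E e^phi and s = F - a one has e^(phi - a) = Y e^s. The quadratic minorant is
    taken at u = rho Y, where E u = rho and E u^2 = rho k for k = rho kappa; dividing by rho leaves
    A - B k. *)
Lemma integral_Gterm_ge a c khat : 0 <= a - 1 + c ->
  (kappa mu phi <= khat%:E)%E -> rho * khat <= 1 / 2 ->
  (logint mu phi + (c - 2 * rho * khat)%:E <=
   \int[mu]_x (Gterm rho (phi x) a + c)%:E)%E.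
Proof.
move=> c0; rewrite kappaE lee_fin => kk rk; have m1 := moment1_gt0.
set s := ln (moment 1) - a; set k := rho * (moment 2 / moment 1 ^+ 2).
have k0 : 0 <= k.
  rewrite mulr_ge0 ?(ltW rho0)// divr_ge0 ?exprn_ge0 ?(ltW m1)//.
  by rewrite (le_trans _ moment2_ge) ?sqr_ge0.
have krk : k <= rho * khat by rewrite ler_pM2l.
have [A [B [AB1 AB2]]] := ln1DexpR_ge_quadratic s.
have /AB2 {}AB2 : 0 <= k <= 1 / 2 by rewrite k0 (le_trans krk).
apply: (@le_trans _ _ (\int[mu]_x (a - 1 + c + A / moment 1 * expR (phi x) +
    (- (B * rho / moment 1 ^+ 2)) * expR (phi x) ^+ 2)%:E)%E).
  rewrite integral_quadratic logintE -EFinD lee_fin.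
  have -> : A / moment 1 * moment 1 = A by rewrite divfK// gt_eqF.
  have -> : - (B * rho / moment 1 ^+ 2) * moment 2 = - (B * k).
    by rewrite /k; ring.
  move: AB2 krk; rewrite /s; lra.
apply: le_integral => //; first exact: integrable_quadratic.
  (* The minorant may be negative, so monotonicity asks for integrability of [Gterm]; a - 1 + c +
     e^(phi - a) dominates it. *)
  apply: (@le_integrable _ _ _ mu _ measurableT _
      (fun x => (a - 1 + c + expR (- a) * expR (phi x) +
               0 * expR (phi x) ^+ 2)%:E)).
  - exact: measurable_GtermD.
  - move=> x _; rewrite !abse_EFin lee_fin.
    have h1 := Gterm_ge (phi x) a rho0; have := Gterm_le (phi x) a rho0.
    rewrite ger0_norm; last by lra.
    rewrite mul0r addr0 -expRD (addrC (- a)).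
    by have := expR_ge0 (phi x - a) => e0; rewrite ger0_norm; lra.
  - exact: (integrable_quadratic (a - 1 + c) (expR (- a)) 0).
move=> x _; rewrite lee_fin.
have u0 : 0 <= rho * (expR (phi x) / moment 1).
  by rewrite mulr_ge0 ?(ltW rho0)// divr_ge0 ?expR_ge0// ltW.
have ri : 0 <= rho^-1 by rewrite invr_ge0 ltW.
have := ler_wpM2l ri (AB1 _ u0).
have -> : rho * (expR (phi x) / moment 1) * expR s = rho * expR (phi x - a).
  rewrite /s !expRD lnK// mulrA; field; rewrite gt_eqF//.
have -> : rho^-1 * (A * (rho * (expR (phi x) / moment 1)) -
      B * (rho * (expR (phi x) / moment 1)) ^+ 2) =
    A / moment 1 * expR (phi x) +
    - (B * rho / moment 1 ^+ 2) * expR (phi x) ^+ 2.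
  by field; rewrite !gt_eqF.
by rewrite /Gterm; move: (_ * ln _) (A / _ * _) (- _ * _ ^+ 2) => z w v; lra.
Qed.

End logint_moments.

(** Induction: the new average is the old one moved towards the new point by the fraction 1 / (n +
    2). *)
Lemma average_in_convex (R : realType) (V : lmodType R) (S : set V)
    (u : nat -> V) n :
  (forall a b t, S a -> S b -> 0 <= t <= 1 -> S (a + t *: (b - a))) ->
  (forall k, S (u k)) -> (0 < n)%N -> S (n%:R^-1 *: \sum_(k < n) u k).
Proof.
move=> convS Su; elim: n => // -[_ _|n IHn _].
  by rewrite big_ord1 invr1 scale1r.
have n0 : n.+2%:R != 0 :> R by rewrite pnatr_eq0.
have n1 : n.+1%:R != 0 :> R by rewrite pnatr_eq0.
rewrite big_ord_recr /=; set s := \sum_(_ < _) _ in IHn *.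
have -> : n.+2%:R^-1 *: (s + u n.+1) = n.+1%:R^-1 *: s +
    n.+2%:R^-1 *: (u n.+1 - n.+1%:R^-1 *: s).
  rewrite !scalerBr scalerDr scalerA addrCA addrC; congr (_ + _).
  rewrite -scalerBl; congr (_ *: _).
  have := n0; rewrite -[n.+2%:R]natr1; move: (n.+1%:R : R) n1 => m m0 m1.
  by field; rewrite m0 m1.
apply: convS; [exact: IHn|exact: Su|].
by rewrite invr_ge0 ler0n/= invf_le1 ?ltr0n// ler1n.
Qed.

(** * Pathwise analysis of the projected subgradient method *)

Section psgd_deterministic.
Context {R : realType} {d : nat} {X : Type}.
Variables (Theta : set 'rV[R]_d) (L : X -> 'rV[R]_d -> R)
  (g : X -> 'rV[R]_d -> 'rV[R]_d) (rho eta a0 a1 : R).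
Hypotheses (Theta0 : Theta !=set0) (cTheta : compact Theta).
Hypothesis convTheta : forall u v (t : R), Theta u -> Theta v -> 0 <= t <= 1 ->
  Theta (u + t *: (v - u)).
Hypothesis a01 : a0 <= a1.
Hypothesis gL : forall x theta, Theta theta ->
  subdifferential Theta (L x) theta (g x theta).
Hypothesis rho01 : 0 < rho <= 1.
Hypothesis eta0 : 0 < eta.
Local Notation A := `[a0, a1]%classic.
Local Notation C := (Theta `*` A).

Lemma rectangle_nonempty : C !=set0.
Proof.
by have [u Tu] := Theta0; exists (u, a0); split => //=; rewrite in_itv/= lexx.
Qed.

Lemma rectangle_compact : compact C.
Proof. by apply: compact_setX => //; exact: segment_compact. Qed.

Lemma itv_convex (a b t : R) : A a -> A b -> 0 <= t <= 1 -> A (a + t * (b - a)).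
Proof.
rewrite /= !in_itv/= => /andP[h1 h2] /andP[h3 h4] /andP[h5 h6].
have := mulr_ge0 h5 (_ : 0 <= b - a0); rewrite subr_ge0 => /(_ h3).
have := mulr_ge0 h5 (_ : 0 <= a1 - b); rewrite subr_ge0 => /(_ h4).
have := mulr_ge0 (_ : 0 <= 1 - t) (_ : 0 <= a - a0);
  rewrite !subr_ge0 => /(_ h6 h1).
have := mulr_ge0 (_ : 0 <= 1 - t) (_ : 0 <= a1 - a);
  rewrite !subr_ge0 => /(_ h6 h2).
move=> ? ? ? ?; apply/andP; split; lra.
Qed.

Lemma rectangle_convex p q t : C p -> C q -> 0 <= t <= 1 ->
  C (p.1 + t *: (q.1 - p.1), p.2 + t * (q.2 - p.2)).
Proof.
move=> [p1 p2] [q1 q2] t01; split; first exact: convTheta.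
exact: itv_convex.
Qed.

Let C0 := rectangle_nonempty.
Let cC := rectangle_compact.
Let convC := rectangle_convex.

(** The two components of the projection as maps of one variable each, with an arbitrary 0 in the
    other slot; they are total retractions onto Theta and A. *)
Definition projTheta (u : 'rV[R]_d) := (eucl_proj C (u, 0)).1.
Definition projA (a : R) := (eucl_proj C (0, a)).2.

Lemma projTheta_in u : Theta (projTheta u).
Proof. by have [] := eucl_proj_in C0 cC (u, 0). Qed.

Lemma projA_in a : A (projA a).
Proof. by have [] := eucl_proj_in C0 cC (0, a). Qed.

Lemma projTheta_id u : Theta u -> projTheta u = u.
Proof.
move=> Tu; rewrite /projTheta -(eucl_proj_fst C0 cC convC (u, a0)).
by rewrite eucl_proj_id//; split => //=; rewrite in_itv/= lexx.
Qed.

Lemma projA_id a : A a -> projA a = a.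
Proof.
move=> Aa; have [u Tu] := Theta0.
by rewrite /projA -(eucl_proj_snd C0 cC convC (u, a)) eucl_proj_id.
Qed.

Lemma eucl_projE z : eucl_proj C z = (projTheta z.1, projA z.2).
Proof.
rewrite [LHS]surjective_pairing; congr (_, _).
  exact: eucl_proj_fst.
exact: eucl_proj_snd.
Qed.

(** Chain rule for subgradients: the inequality for L may be multiplied by the weight because the
    weight is nonnegative. *)
Lemma Gterm_convex x z p : C z -> Theta p.1 ->
  Gterm rho (L x z.1) z.2 +
    dotp (g_rho L g rho x z).1 (p.1 - z.1) + (g_rho L g rho x z).2 * (p.2 - z.2)
  <= Gterm rho (L x p.1) p.2.
Proof.
move=> [Tz _] Tp; have /andP[r0 _] := rho01.
have := Gterm_subgradient (L x z.1) z.2 (L x p.1) p.2 r0.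
apply: le_trans; rewrite /g_rho /= -/(weight rho (L x z.1) z.2) dotpZl.
rewrite lerD2r lerD2l; apply: ler_wpM2l; first exact: weight_ge0.
by rewrite lerBrDl; exact: gL.
Qed.

Variables (z1 : 'rV[R]_d * R) (xs : nat -> X).
Hypothesis Cz1 : C z1.
Local Notation z := (psgd L g rho C eta z1 xs).

Lemma psgd_in k : C (z k).
Proof. by case: k => [|k] //=; exact: (eucl_proj_in C0 cC). Qed.

(** Projecting does not increase the distance to p. Expand the square of the unprojected step, bound
    the cross term by convexity and |h|^2 by [sqr_g_rho_le]. No term is subtracted, which suits
    integration in the extended reals. *)
Lemma psgd_step k p : C p ->
  2 * eta * (Gterm rho (L (xs k) (z k).1) (z k).2) +
    (dotp ((z k.+1).1 - p.1) ((z k.+1).1 - p.1) + ((z k.+1).2 - p.2) ^+ 2) <=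
  dotp ((z k).1 - p.1) ((z k).1 - p.1) + ((z k).2 - p.2) ^+ 2 +
    2 * eta * Gterm rho (L (xs k) p.1) p.2 +
    eta ^+ 2 / rho ^+ 2 *
      (dotp (g (xs k) (z k).1) (g (xs k) (z k).1) + 1).
Proof.
move=> Cp; have Cz := psgd_in k.
have h3 := Gterm_convex (xs k) Cz (proj1 Cp).
have h2 := sqr_g_rho_le L g (xs k) (z k) rho01.
rewrite -[z k.+1]/(eucl_proj C ((z k).1 - eta *: (g_rho L g rho (xs k) (z k)).1,
  (z k).2 - eta * (g_rho L g rho (xs k) (z k)).2)).
move: (g_rho L g rho (xs k) (z k)) h2 h3 => h.
have := eucl_proj_le C0 cC convC ((z k).1 - eta *: h.1, (z k).2 - eta * h.2) Cp.
move: (eucl_proj C _) => z' /=.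
have -> : (z k).1 - eta *: h.1 - p.1 = (z k).1 - p.1 - eta *: h.1.
  by rewrite addrAC.
rewrite -(opprB (z k).1 p.1); move: ((z k).1 - p.1) => v.
have -> : dotp (v - eta *: h.1) (v - eta *: h.1) =
    dotp v v - 2 * eta * dotp h.1 v + eta ^+ 2 * dotp h.1 h.1.
  by rewrite !dotpE (dotpC v h.1); ring.
rewrite dotpNr.
rewrite [X in _ -> _ -> _ <= _ + X]mulrAC -[X in _ -> _ -> _ <= _ + X]mulrA.
set W := (_ + 1) / rho ^+ 2; set D := dotp (z'.1 - _) _.
move: W D (dotp h.1 h.1) (dotp h.1 v) (dotp v v) => W D hh hv vv.
move: (Gterm _ _ _) (Gterm _ _ _) => G1 G2 h1.
move=> /(ler_wpM2l (exprn_ge0 2 (ltW eta0))) h2.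
move=> /(ler_wpM2l (mulr_ge0 (ler0n _ 2) (ltW eta0))) h3.
lra.
Qed.

(** Jensen by hand: in the sum of the subgradient inequalities based at the average, the linear
    terms cancel. *)
Lemma Gterm_avg x n : (0 < n)%N ->
  Gterm rho (L x (n%:R^-1 *: \sum_(k < n) (z k).1))
    (n%:R^-1 * \sum_(k < n) (z k).2)
  <= n%:R^-1 * \sum_(k < n) Gterm rho (L x (z k).1) (z k).2.
Proof.
move=> n0; have nn0 : n%:R != 0 :> R by rewrite pnatr_eq0 -lt0n.
set u := n%:R^-1 *: _; set a := n%:R^-1 * _.
have Tu : Theta u.
  by apply: (@average_in_convex R _ Theta (fun k => (z k).1)) => // k; have [] := psgd_in k.
have Aa : A a.
  apply: (@average_in_convex R R^o A (fun k => (z k).2)) => //.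
    exact: itv_convex.
  by move=> k; have [] := psgd_in k.
rewrite -(ler_pM2l (_ : 0 < n%:R)) ?ltr0n// mulrA divff// mul1r.
have -> : n%:R * Gterm rho (L x u) a = \sum_(k < n)
  (Gterm rho (L x u) a + dotp (g_rho L g rho x (u, a)).1 ((z k).1 - u) +
   (g_rho L g rho x (u, a)).2 * ((z k).2 - a)).
  have nu : u *+ n = \sum_(k < n) (z k).1.
    by rewrite -scaler_nat /u scalerA divff// scale1r.
  have na : a *+ n = \sum_(k < n) (z k).2.
    by rewrite -mulr_natl /a mulrA divff// mul1r.
  move: (g_rho L g rho x (u, a)) (Gterm rho (L x u) a) => h G.
  rewrite 2!big_split /= sumr_const card_ord -dotp_sumr -mulr_sumr !sumrB.
  by rewrite !sumr_const card_ord nu na !subrr dotp0r mulr0 !addr0 mulr_natl.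
apply: ler_sum => k _; apply: (@Gterm_convex x (u, a) (z k)) => //.
by have [] := psgd_in k.
Qed.

End psgd_deterministic.

(** * Expectations along the method *)

Section psgd_stochastic.
Context {dO dX : measure_display} {Omega : measurableType dO}
  {X : measurableType dX} {R : realType} {d : nat}.
Variables (Pr : probability Omega R) (xi : nat -> {RV Pr >-> X})
  (mu : probability X R) (Theta : set 'rV[R]_d) (L : X -> 'rV[R]_d -> R)
  (g : X -> 'rV[R]_d -> 'rV[R]_d) (rho eta a0 a1 c M khat : R).
Hypotheses (Theta0 : Theta !=set0) (cTheta : compact Theta).
Hypothesis convTheta : forall u v (t : R), Theta u -> Theta v -> 0 <= t <= 1 ->
  Theta (u + t *: (v - u)).
Hypothesis a01 : a0 <= a1.
Hypothesis mL : forall theta, Theta theta -> measurable_fun setT (L ^~ theta).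
Hypothesis mg : jointly_measurable Theta g.
Hypothesis gL : forall x theta, Theta theta ->
  subdifferential Theta (L x) theta (g x theta).
Hypothesis gM : forall theta, Theta theta ->
  (\int[mu]_x (eucl_norm (g x theta) ^+ 2)%:E <= (M ^+ 2)%:E)%E.
Hypothesis rho01 : 0 < rho <= 1.
Hypothesis eta0 : 0 < eta.
Hypothesis c0 : 0 <= a0 - 1 + c.
Hypothesis iid : iid_with_law mu xi.
Local Notation A := `[a0, a1]%classic.
Local Notation C := (Theta `*` A).
Local Notation r := (projTheta Theta a0 a1).
Local Notation ra := (projA Theta a0 a1).
Variables (z1 : 'rV[R]_d * R).
Hypothesis Cz1 : C z1.
Local Notation z k w := (psgd L g rho C eta z1 (fun j => xi j w) k).

Let rho0 : 0 < rho. Proof. by have /andP[] := rho01. Qed.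

Let Pr_cst (b : R) : (\int[Pr]_w (cst b%:E) w = b%:E)%E.
Proof.
by rewrite integral_cst// -[X in (_ * X)%E]/(Pr setT) probability_setT mule1.
Qed.

Let mr : measurable_fun setT (r : borel_rV R d -> borel_rV R d).
Proof.
apply: measurable_fun_rV => i; apply: continuous_measurable_rV.
apply: continuous_eucl_proj_fst; first exact: rectangle_nonempty.
  exact: rectangle_compact.
exact: rectangle_convex.
Qed.

Let mra : measurable_fun setT ra.
Proof.
apply: continuous_measurable_fun; apply: continuous_eucl_proj_snd.
- exact: rectangle_nonempty.
- exact: rectangle_compact.
- exact: rectangle_convex.
Qed.

Let clTheta : closed Theta.
Proof. by apply: compact_closed => //; exact: norm_hausdorff. Qed.

Let rTheta u : Theta (r u).
Proof. exact: projTheta_in. Qed.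

Let raA a : A (ra a).
Proof. exact: projA_in. Qed.

Section composition.
Context {dT : measure_display} {T : measurableType dT}.
Variables (f : T -> X) (h : T -> borel_rV R d).
Hypotheses (mf : measurable_fun setT f) (mh : measurable_fun setT h).

Lemma measurable_L_proj : measurable_fun setT (fun t => L (f t) (r (h t))).
Proof.
have [theta Ttheta] := Theta0.
have mLr := measurable_jointly_convex convTheta gL rTheta Ttheta clTheta mr mg
  (mL Ttheta).
exact: (measurableT_comp mLr (measurable_fun_pair mf mh)).
Qed.

Lemma measurable_g_proj :
  measurable_fun setT (fun t => g (f t) (r (h t)) : borel_rV R d).
Proof.
apply: (measurable_jointly_comp clTheta mg (h := r \o h)) => //.
- by move=> t; exact: rTheta.
- exact: (measurableT_comp mr mh).
Qed.

End composition.

Let zC k w : C (z k w).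
Proof. exact: psgd_in. Qed.

Let rz k w : r (z k w).1 = (z k w).1.
Proof. by apply: projTheta_id => //; have [] := zC k w. Qed.

Let raz k w : ra (z k w).2 = (z k w).2.
Proof. by apply: (projA_id Theta0) => //; have [] := zC k w. Qed.

(** With [r p.1] in place of [p.1], loss and oracle become functions on all of R^d, to which the
    joint measurability results apply. *)
Let projected_step x (p : 'rV[R]_d * R) : r p.1 = p.1 ->
  let s := weight rho (L x (r p.1)) p.2 in
  eucl_proj C (p.1 - eta *: (g_rho L g rho x p).1,
               p.2 - eta * (g_rho L g rho x p).2) =
  (r (p.1 - eta *: (s *: g x (r p.1))), ra (p.2 - eta * (1 - s))).
Proof. by move=> rp s; rewrite /s rp (eucl_projE Theta0). Qed.

(** Step k consumes sample k, so iterate k depends only on the samples of index below k, as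
    [past xi k] records. *)
Lemma psgd_adapted k :
  measurable_fun setT ((fun w => (z k w).1) : past_algebra xi k -> borel_rV R d)
  /\ measurable_fun setT ((fun w => (z k w).2) : past_algebra xi k -> R).
Proof.
elim: k => [|k [IH1 IH2]]; first by split; exact: measurable_cst.
have m1 := measurable_past_mono IH1; have m2 := measurable_past_mono IH2.
have mx : measurable_fun setT (xi k : past_algebra xi k.+1 -> X).
  exact: measurable_xi_past.
pose wt w := weight rho (L (xi k w) (r (z k w).1)) (z k w).2.
have mw : measurable_fun setT (wt : past_algebra xi k.+1 -> R).
  by apply: measurable_weight => //; exact: measurable_L_proj.
have E w := projected_step (xi k w) (rz k w).
split.
- apply: (@eq_measurable_fun _ _ (past_algebra xi k.+1) (borel_rV R d) setT
    (fun w => r ((z k w).1 - eta *: (wt w *: g (xi k w) (r (z k w).1))))).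
    by move=> w _; exact: esym (congr1 fst (E w)).
  apply: (measurableT_comp mr); apply: measurable_funB_rV => //.
  apply: measurable_funZ_rV => //; apply: measurable_funZ_rV => //.
  exact: measurable_g_proj.
- apply: (@eq_measurable_fun _ _ (past_algebra xi k.+1) R setT
    (fun w => ra ((z k w).2 - eta * (1 - wt w)))).
    by move=> w _; exact: esym (congr1 snd (E w)).
  apply: (measurableT_comp mra); apply: measurable_funB => //.
  by apply: measurable_funM => //; exact: measurable_funB.
Qed.

Let mz1 k : measurable_fun setT (fun w => (z k w).1 : borel_rV R d).
Proof. by have [+ _] := psgd_adapted k; exact: measurable_past_sub. Qed.

Let mz2 k : measurable_fun setT (fun w => (z k w).2).
Proof. by have [_ +] := psgd_adapted k; exact: measurable_past_sub. Qed.

Let mxi k : measurable_fun setT (xi k : Omega -> X).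
Proof. exact: measurable_funP. Qed.

Lemma expect_indep k (f : X * (borel_rV R d * R) -> \bar R) :
  measurable_fun setT f -> (forall p, 0 <= f p)%E ->
  (\int[Pr]_w f (xi k w, ((z k w).1 : borel_rV R d, (z k w).2)) =
   \int[Pr]_w \int[mu]_x f (x, ((z k w).1 : borel_rV R d, (z k w).2)))%E.
Proof.
move=> mf f0; have [indep law] := iid; have [m1 m2] := psgd_adapted k.
apply: (integral_indep indep law) => //.
exact: measurable_fun_pair.
Qed.

(** The shift [c] is at least 1 - a0, and a0 bounds the second component from below. *)
Let Gpos x u a : 0 <= Gterm rho (L x u) (ra a) + c.
Proof.
have /andP[h _] : a0 <= ra a <= a1 by have := raA a; rewrite /= in_itv.
have := Gterm_ge (L x u) (ra a) rho0; move: (ra a) (Gterm _ _ _) h c0.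
by move=> b G h1 h2 h3; lra.
Qed.

Let Gz_ge0 x k w : 0 <= Gterm rho (L x (z k w).1) (z k w).2 + c.
Proof. by have := Gpos x (z k w).1 (z k w).2; rewrite raz. Qed.

Let mGf : measurable_fun setT (fun p : X * (borel_rV R d * R) =>
  (Gterm rho (L p.1 (r p.2.1)) (ra p.2.2) + c)%:E).
Proof.
have m21 : measurable_fun setT (fun p : X * (borel_rV R d * R) => p.2.1).
  exact: (measurableT_comp measurable_fst measurable_snd).
have m22 : measurable_fun setT (fun p : X * (borel_rV R d * R) => p.2.2).
  exact: (measurableT_comp measurable_snd measurable_snd).
apply/measurable_EFinP; apply: measurable_funD => //; apply: measurable_Gterm.
  by apply: measurable_L_proj => //; exact: measurable_fst.
exact: (measurableT_comp mra m22).
Qed.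

(** G_rho at iterate k, plus [c]: the sample is integrated out with the iterate held fixed. *)
Let H k w := (\int[mu]_x (Gterm rho (L x (z k w).1) (z k w).2 + c)%:E)%E.

Let mH k : measurable_fun setT (H k).
Proof.
have mG : measurable_fun setT (fun s : borel_rV R d * R =>
    \int[mu]_x (Gterm rho (L x (r s.1)) (ra s.2) + c)%:E)%E.
  by apply: (measurable_fun_fubini_tonelli_G (m1 := mu) _ mGf) => p; rewrite lee_fin.
have := measurableT_comp mG (measurable_fun_pair (mz1 k) (mz2 k)).
apply: eq_measurable_fun => w _; rewrite /=.
by apply: eq_integral => x _; rewrite rz raz.
Qed.


Let Gt k w := Gterm rho (L (xi k w) (z k w).1) (z k w).2 + c.

Let mGt k : measurable_fun setT (Gt k).
Proof.
apply: measurable_funD => //; apply: measurable_Gterm => //.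
apply: (@eq_measurable_fun _ _ _ _ setT
  (fun w => L (xi k w) (r (z k w).1))) => [w _|]; first by rewrite rz.
exact: measurable_L_proj.
Qed.

Let gz k w := dotp (g (xi k w) (z k w).1) (g (xi k w) (z k w).1).

Let mgz k : measurable_fun setT (gz k).
Proof.
apply: measurable_dotp;
  apply: (@eq_measurable_fun _ _ Omega (borel_rV R d) setT
    (fun w => g (xi k w) (r (z k w).1))) => [w _|]; rewrite ?rz//;
  exact: measurable_g_proj.
Qed.

(** Iterate k is independent of sample k. The retractions fix the iterates; they are inserted so
    that [mGf] applies, then removed. *)
Lemma expect_Gterm k : (\int[Pr]_w (Gt k w)%:E = \int[Pr]_w H k w)%E.
Proof.
have := expect_indep k mGf (fun p => _).
move=> /(_ (fun p => Gpos _ _ _)) /=.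
under eq_integral do rewrite rz raz.
move=> ->; apply: eq_integral => w _.
by apply: eq_integral => x _; rewrite rz raz.
Qed.

Lemma expect_sqr_g k : (\int[Pr]_w (gz k w)%:E <= (M ^+ 2)%:E)%E.
Proof.
pose f (p : X * (borel_rV R d * R)) :=
  (dotp (g p.1 (r p.2.1)) (g p.1 (r p.2.1)))%:E.
have m21 : measurable_fun setT (fun p : X * (borel_rV R d * R) => p.2.1).
  exact: (measurableT_comp measurable_fst measurable_snd).
have mf : measurable_fun setT f.
  apply/measurable_EFinP; apply: measurable_dotp;
    apply: measurable_g_proj => //; exact: measurable_fst.
have f0 p : (0 <= f p)%E by rewrite lee_fin dotpxx_ge0.
have := expect_indep k mf f0; rewrite /f /=.
under eq_integral do rewrite rz.
move=> ->; have -> : ((M ^+ 2)%:E = \int[Pr]_w (cst (M ^+ 2)%:E) w)%E.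
  by rewrite Pr_cst.
apply: ge0_le_integral => //.
- by move=> w _; apply: integral_ge0 => x _; rewrite lee_fin dotpxx_ge0.
- have mG := measurable_fun_fubini_tonelli_G (m1 := mu) _ mf f0.
  exact: (measurableT_comp mG (measurable_fun_pair (mz1 k) (mz2 k))).
- move=> w _; apply: le_trans (gM (rTheta (z k w).1)).
  by under [leRHS]eq_integral do rewrite sqr_eucl_norm.
Qed.

Variables (theta : 'rV[R]_d) (fs : R).
Hypotheses (Ttheta : Theta theta) (Afs : A fs).
Hypothesis phi2 : forall u, Theta u ->
  (logint mu (fun x => 2 * L x u)%R < +oo)%E.
Hypothesis Ftheta : logint mu (L ^~ theta) = fs%:E.
Hypothesis Fmin : forall u, Theta u -> (fs%:E <= logint mu (L ^~ u))%E.

Let Gs k w := Gterm rho (L (xi k w) theta) fs + c.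

Let fsc : 0 <= fs - 1 + c.
Proof.
by move: Afs; rewrite /= in_itv/= => /andP[h _]; rewrite (le_trans c0)// !lerD2r.
Qed.

Let Gs_ge0 k w : 0 <= Gs k w.
Proof.
by have := Gterm_ge (L (xi k w) theta) fs rho0; move: fsc; rewrite /Gs; lra.
Qed.

Let mGs k : measurable_fun setT (Gs k).
Proof.
apply: measurable_funD => //; apply: measurable_Gterm => //.
exact: (measurableT_comp (mL Ttheta) (mxi k)).
Qed.

(** Sample k has law mu, so this is the upper estimate of G_rho at (theta, F(theta)). *)
Lemma expect_Gterm_star k : (\int[Pr]_w (Gs k w)%:E <= (fs + c)%:E)%E.
Proof.
have mfs : measurable_fun setT (fun x => (Gterm rho (L x theta) fs + c)%:E).
  apply/measurable_EFinP; apply: measurable_funD => //.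
  by apply: measurable_Gterm => //; exact: mL.
have fs0 x : (0 <= (Gterm rho (L x theta) fs + c)%:E)%E.
  by have := Gterm_ge (L x theta) fs rho0; move: fsc; rewrite lee_fin; lra.
have <- : (\int[distribution Pr (xi k)]_x (Gterm rho (L x theta) fs + c)%:E =
    \int[Pr]_w (Gs k w)%:E)%E.
  by rewrite ge0_integral_pushforward.
rewrite (eq_measure_integral mu); last by move=> B mB _; apply: (proj2 iid).
have fsE : fs = ln (moment mu (L ^~ theta) 1).
  by move: Ftheta; rewrite (logintE (mL Ttheta) (phi2 Ttheta)) => -[].
have := integral_Gterm_le (mL Ttheta) (phi2 Ttheta) rho0 (c := c).
by rewrite -fsE Ftheta -EFinD; exact.
Qed.

Let D k w := dotp ((z k w).1 - theta) ((z k w).1 - theta) +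
  ((z k w).2 - fs) ^+ 2.

Let D_ge0 k w : 0 <= D k w.
Proof. by rewrite addr_ge0 ?dotpxx_ge0 ?sqr_ge0. Qed.

Let mD k : measurable_fun setT (D k).
Proof.
apply: measurable_funD.
  by apply: measurable_dotp; apply: measurable_funB_rV => //; exact: measurable_cst.
by apply: measurable_funX; exact: measurable_funB.
Qed.

Let B := 2 * eta * (fs + c) + eta ^+ 2 / rho ^+ 2 * (M ^+ 2 + 1).

(** Integrate [psgd_step] at p = (theta, fs), shifted by [c]; [B] collects the optimal value and the
    second moment of the subgradient. *)
Lemma expect_step k :
  ((2 * eta)%:E * \int[Pr]_w H k w + \int[Pr]_w (D k.+1 w)%:E <=
   \int[Pr]_w (D k w)%:E + B%:E)%E.
Proof.
have e0 : 0 <= 2 * eta by rewrite mulr_ge0// ltW.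
have W0 : 0 <= eta ^+ 2 / rho ^+ 2 by rewrite divr_ge0 ?sqr_ge0.
have Gt0 w : (0 <= (Gt k w)%:E)%E by rewrite lee_fin Gz_ge0.
have gz0 w : 0 <= gz k w + 1 by rewrite addr_ge0 ?dotpxx_ge0.
have mgz1 : measurable_fun setT (fun w => gz k w + 1).
  exact: measurable_funD.
rewrite -expect_Gterm -ge0_integralZl_EFin//; last exact/measurable_EFinP.
rewrite -ge0_integralD//; last 4 first.
- by move=> w _; rewrite mule_ge0.
- by apply/measurable_EFinP; exact: measurable_funM.
- by move=> w _; rewrite lee_fin.
- exact/measurable_EFinP.
apply: (@le_trans _ _ (\int[Pr]_w ((D k w)%:E +
  ((2 * eta)%:E * (Gs k w)%:E + (eta ^+ 2 / rho ^+ 2)%:E * (gz k w + 1)%:E)))%E).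
  apply: ge0_le_integral => //.
  - by move=> w _; rewrite adde_ge0 ?mule_ge0// lee_fin.
  - apply/measurable_EFinP; apply: measurable_funD => //.
    exact: measurable_funM.
  - apply/measurable_EFinP; apply: measurable_funD => //.
    by apply: measurable_funD; exact: measurable_funM.
  - move=> w _; rewrite -!EFinM -!EFinD lee_fin.
    have Cp : C (theta, fs) by [].
    have := psgd_step Theta0 cTheta convTheta a01 gL rho01 eta0
      (fun j => xi j w) Cz1 k Cp.
    rewrite -/(D k w) -/(D k.+1 w) -/(gz k w) /Gt /Gs /=.
    move: (Gterm _ _ _) (Gterm _ _ _) (D k w) (D k.+1 w) (_ / _ * _).
    by move=> G1 G2 D1 D2 W; lra.
rewrite ge0_integralD//; last 4 first.
- by move=> w _; rewrite lee_fin.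
- exact/measurable_EFinP.
- by move=> w _; rewrite !adde_ge0 ?mule_ge0 ?lee_fin.
- by apply/measurable_EFinP; apply: measurable_funD; exact: measurable_funM.
apply: leeD => //; rewrite ge0_integralD//; last 4 first.
- by move=> w _; rewrite mule_ge0 ?lee_fin.
- by apply/measurable_EFinP; exact: measurable_funM.
- by move=> w _; rewrite mule_ge0 ?lee_fin.
- by apply/measurable_EFinP; exact: measurable_funM.
have gz0e w : (0 <= (gz k w + 1)%:E)%E by rewrite lee_fin.
have Gs0e w : (0 <= (Gs k w)%:E)%E by rewrite lee_fin.
rewrite ge0_integralZl_EFin//; last exact/measurable_EFinP.
rewrite ge0_integralZl_EFin//; last exact/measurable_EFinP.
rewrite /B EFinD !EFinM; apply: leeD.
  by rewrite -EFinM lee_wpmul2l ?lee_fin// expect_Gterm_star.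
rewrite lee_wpmul2l ?lee_fin//; under eq_integral do rewrite EFinD.
rewrite ge0_integralD//; last 2 first.
- by move=> w _; rewrite lee_fin dotpxx_ge0.
- exact/measurable_EFinP.
rewrite EFinD; apply: leeD; first exact: expect_sqr_g.
by have := Pr_cst 1; rewrite /cst => ->.
Qed.

Let H_ge0 k w : (0 <= H k w)%E.
Proof. by apply: integral_ge0 => x _; rewrite lee_fin. Qed.

(** Telescoping of [expect_step]; the base case uses that the initial point is deterministic. *)
Lemma expect_sum n :
  ((2 * eta)%:E * (\sum_(k < n) \int[Pr]_w H k w) + \int[Pr]_w (D n w)%:E <=
   (dotp (z1.1 - theta) (z1.1 - theta) + (z1.2 - fs) ^+ 2 + n%:R * B)%:E)%E.
Proof.
elim: n => [|n IHn].
  rewrite big_ord0 mule0 add0e mul0r addr0.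
  rewrite -[X in (X <= _)%E]/(\int[Pr]_w
    (cst (dotp (z1.1 - theta) (z1.1 - theta) + (z1.2 - fs) ^+ 2)%:E) w)%E.
  by rewrite Pr_cst.
have iH k : (0 <= \int[Pr]_w H k w)%E by apply: integral_ge0 => w _; exact: H_ge0.
rewrite big_ord_recr /= ge0_muleDr ?sume_ge0// -addeA.
apply: (le_trans (leeD (lexx _) (expect_step n))).
rewrite addeA; apply: (le_trans (leeD2r B%:E IHn)).
by rewrite -EFinD lee_fin -natr1 mulrDl mul1r [leRHS]addrA.
Qed.

Hypothesis kk : forall u, Theta u -> (kappa mu (L ^~ u) <= khat%:E)%E.
Hypothesis rk : rho * khat <= 1 / 2.
Local Notation avg n w :=
  (psgd_avg_theta L g rho C eta z1 (fun j => xi j w) n).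

Let avg_in n w : (0 < n)%N -> Theta (avg n w).
Proof.
move=> n0; apply: (average_in_convex (u := fun k => (z k w).1)) => // k.
by have [] := zC k w.
Qed.

(** Lower estimate of G_rho at the averaged pair, followed by Jensen under the integral over x. *)
Lemma logint_avg_le n w : (0 < n)%N ->
  (logint mu (L ^~ (avg n w)) + (c - 2 * rho * khat)%:E <=
   n%:R^-1%:E * \sum_(k < n) H k w)%E.
Proof.
move=> n0; have Tavg := avg_in w n0.
pose ab := n%:R^-1 * \sum_(k < n) (z k w).2.
have Aab : A ab.
  apply: (@average_in_convex R R^o A (fun k => (z k w).2)) => //.
    exact: itv_convex.
  by move=> k; have [] := zC k w.
have cab : 0 <= ab - 1 + c.
  by move: Aab; rewrite /= in_itv/= => /andP[h _]; rewrite (le_trans c0)// !lerD2r.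
have mGz k : measurable_fun setT
    (fun x => (Gterm rho (L x (z k w).1) (z k w).2 + c)%:E).
  apply/measurable_EFinP; apply: measurable_funD => //.
  by apply: measurable_Gterm => //; apply: mL; have [] := zC k w.
have Gz0 k x : (0 <= (Gterm rho (L x (z k w).1) (z k w).2 + c)%:E)%E.
  by rewrite lee_fin.
apply: (le_trans (integral_Gterm_ge (mL Tavg) (phi2 Tavg) rho0 cab (kk Tavg) rk)).
rewrite /H -ge0_integral_sum// -ge0_integralZl_EFin//; last 2 first.
- by move=> x _; apply: sume_ge0.
- exact: emeasurable_sum.
apply: ge0_le_integral => //.
- move=> x _; rewrite lee_fin; have := Gterm_ge (L x (avg n w)) ab rho0.
  by move: cab; lra.
- apply/measurable_EFinP; apply: measurable_funD => //.
  by apply: measurable_Gterm => //; exact: mL.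
- by apply: measurable_funeM; exact: emeasurable_sum.
- move=> x _; rewrite sumEFin -EFinM lee_fin big_split /= mulrDr.
  rewrite sumr_const card_ord -[c *+ n]mulr_natl mulrA mulVf ?pnatr_eq0 -?lt0n//.
  rewrite mul1r lerD2r.
  exact: (Gterm_avg eta Theta0 cTheta convTheta a01 gL rho01
    (fun j => xi j w) Cz1 x n0).
Qed.

Lemma expect_gap n : (0 < n)%N ->
  (\int[Pr]_w (logint mu (L ^~ (avg n w)) - fs%:E) <=
   ((dotp (z1.1 - theta) (z1.1 - theta) + (z1.2 - fs) ^+ 2) / (2 * eta * n%:R) +
    eta * (M ^+ 2 + 1) / (2 * rho ^+ 2) + 2 * rho * khat)%:E)%E.
Proof.
move=> n0; set D0 := dotp _ _ + _.
pose l w := ln (moment mu (L ^~ (avg n w)) 1).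
have lE w : logint mu (L ^~ (avg n w)) = (l w)%:E.
  have Tavg := avg_in w n0; exact: (logintE (mL Tavg) (phi2 Tavg)).
have l0 w : fs <= l w by rewrite -lee_fin -lE Fmin//; exact: avg_in.
have mavg : measurable_fun setT (fun w => avg n w : borel_rV R d).
  apply: measurable_funZ_rV => //; apply: measurable_fun_rV => i.
  under eq_fun do rewrite summxE.
  by apply: measurable_sumr => k; exact: measurable_fun_coord.
(* F at the average is a partial integral of a jointly measurable function composed with the
   average, on which [r] is the identity. *)
have ml : measurable_fun setT l.
  have mf : measurable_fun setT
      (fun p : X * borel_rV R d => (expR (L p.1 (r p.2)) ^+ 1)%:E).
    apply/measurable_EFinP; apply: measurable_funX; apply: measurableT_comp => //.
    by apply: measurable_L_proj; [exact: measurable_fst|exact: measurable_snd].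
  have f0 p : (0 <= (expR (L p.1 (r p.2)) ^+ 1)%:E)%E by rewrite lee_fin expr1 expR_ge0.
  have mG := measurable_fun_fubini_tonelli_G (m1 := mu) _ mf f0.
  apply: (measurableT_comp (@measurable_ln R)).
  apply: (measurableT_comp (fine_measurable measurableT)).
  apply: (@eq_measurable_fun _ _ _ _ setT
    (fun w => \int[mu]_x (expR (L x (r (avg n w))) ^+ 1)%:E)%E) => [w _|].
    by rewrite (projTheta_id Theta0)//; exact: avg_in.
  exact: (measurableT_comp mG mavg).
under eq_integral do rewrite lE.
have fc0 : 0 <= fs + c by move: fsc; lra.
have krho0 : 0 <= 2 * rho * khat.
  have [u Tu] := Theta0; rewrite mulr_ge0//; first by rewrite mulr_ge0// ltW.
  by rewrite -lee_fin; apply: le_trans (kk Tu); exact: expeR_ge0.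
have sumH0 w : (0 <= \sum_(k < n) H k w)%E by apply: sume_ge0.
have msumH : measurable_fun setT (fun w => \sum_(k < n) H k w)%E.
  by apply: emeasurable_sum.
have ni0 : 0 <= n%:R^-1 :> R by rewrite invr_ge0.
(* Adding fs + c to both sides keeps every integrand nonnegative; it is cancelled when the bounds
   are combined. *)
have step1 : (\int[Pr]_w ((l w)%:E - fs%:E) + (fs + c)%:E <=
    n%:R^-1%:E * (\sum_(k < n) \int[Pr]_w H k w) + (2 * rho * khat)%:E)%E.
  rewrite -{1}(Pr_cst (fs + c)) -(Pr_cst (2 * rho * khat)) -ge0_integralD//;
    last 2 first.
  - by move=> w _; rewrite -EFinB lee_fin subr_ge0.
  - by apply/measurable_EFinP; exact: measurable_funB.
  rewrite -ge0_integral_sum// -ge0_integralZl_EFin// -ge0_integralD//; last 2 first.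
  - by move=> w _; rewrite mule_ge0.
  - exact: measurable_funeM.
  apply: ge0_le_integral => //.
  - by move=> w _; rewrite adde_ge0// -?EFinB lee_fin ?subr_ge0.
  - by apply/measurable_EFinP; apply: measurable_funD => //; exact: measurable_funB.
  - by apply: emeasurable_funD => //; exact: measurable_funeM.
  - move=> w _; have := logint_avg_le w n0; rewrite lE => h.
    apply: le_trans (leeD h (lexx _)).
    by rewrite -!EFinD lee_fin; lra.
(* The last squared distance is discarded. *)
have step2 : (\sum_(k < n) \int[Pr]_w H k w <=
    (2 * eta)^-1%:E * (D0 + n%:R * B)%:E)%E.
  rewrite lee_pdivlMl ?mulr_gt0//; apply: le_trans (expect_sum n).
  by rewrite leeDl// integral_ge0// => w _; rewrite lee_fin.
rewrite -(@leeD2rE R (fs + c)%:E)//; apply: (le_trans step1).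
apply: (@le_trans _ _ (n%:R^-1%:E * ((2 * eta)^-1%:E * (D0 + n%:R * B)%:E) +
  (2 * rho * khat)%:E)%E).
  by rewrite leeD2r// lee_wpmul2l// lee_fin.
rewrite -!EFinM -!EFinD lee_fin le_eqVlt; apply/orP; left; apply/eqP.
by rewrite /B; field; rewrite pnatr_eq0 -lt0n n0 !gt_eqF.
Qed.

End psgd_stochastic.

(** * Near-closest minimisers and the final bound *)

(** The infimum need not be attained, but D < sqrt (D^2 + delta) leaves room for a point of S. The
    slack sits on the squared distance, which enters the final bound linearly. *)
Lemma near_distance_attained (R : realType) (d : nat) (S : set 'rV[R]_d) u
    (D delta : R) : S !=set0 -> eucl_dist u S <= D -> 0 < delta ->
  exists2 v, S v & dotp (u - v) (u - v) <= D ^+ 2 + delta.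
Proof.
move=> [v0 Sv0] uSD delta0.
have Dlt : D < Num.sqrt (D ^+ 2 + delta).
  rewrite (le_lt_trans (ler_norm D))// -sqrtr_sqr ltr_sqrt ?ltrDl//.
  by rewrite ltr_wpDl ?sqr_ge0.
have : eucl_dist u S < Num.sqrt (D ^+ 2 + delta) := le_lt_trans uSD Dlt.
move/inf_lt => [|_ [v Sv <-] uv]; first by exists (eucl_norm (u - v0)), v0.
exists v => //; rewrite -sqr_eucl_norm -[leRHS]sqr_sqrtr; last first.
  by rewrite addr_ge0 ?sqr_ge0 ?ltW.
by rewrite ler_pXn2r ?nnegrE ?sqrtr_ge0 ?ltW.
Qed.

Lemma convex_set_segment (R : realType) (V : lmodType R) (S : set V) u v (t : R) :
  convex_set S -> S u -> S v -> 0 <= t <= 1 -> S (u + t *: (v - u)).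
Proof.
move=> convS Su Sv /andP[t0 t1].
have := convS v u (Itv01 t0 t1) (mem_set Sv) (mem_set Su) => /set_mem.
have -> // : conv (Itv01 t0 t1) (v : convex_lmodType V) u = u + t *: (v - u).
rewrite -[LHS]/(t *: v + (1 - t) *: u) scalerBl scale1r scalerBr addrCA.
by rewrite addrC.
Qed.

Theorem theorem2p9 (R : realType) (d : nat)
    (dX : measure_display) (X : measurableType dX) (mu : probability X R)
    (Theta : set 'rV[R]_d) (L : X -> 'rV[R]_d -> R)
    (g : X -> 'rV[R]_d -> 'rV[R]_d) (M Flow U khat rho Dstar : R)
    (theta1 : 'rV[R]_d) (alpha1 : R) (N : nat)
    (dO : measure_display) (Omega : measurableType dO)
    (Pr : probability Omega R) (xi : nat -> {RV Pr >-> X}) :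
  let F := fun theta => logint mu (L ^~ theta) in
  let Fstar := ereal_inf [set F theta | theta in Theta] in
  let ThetaStar := argmin Theta F in
  let A : set R := `[Flow - 2 * khat * rho, U]%classic in
  let Rad : R := Num.sqrt (Dstar ^+ 2 + (U - Flow + 2 * rho * khat) ^+ 2) in
  let eta : R := rho * Rad / Num.sqrt (N%:R * (M ^+ 2 + 1)) in
  Theta !=set0 -> compact Theta -> convex_set Theta ->
  (forall theta, Theta theta -> measurable_fun setT (L ^~ theta)) ->
  (forall x, convex_function Theta (L x)) ->
  jointly_measurable Theta g ->
  (forall x theta, Theta theta ->
     subdifferential Theta (L x) theta (g x theta)) ->
  0 <= M ->
  (forall theta, Theta theta ->
     (\int[mu]_x (eucl_norm (g x theta) ^+ 2)%:E <= (M ^+ 2)%:E)%E) ->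
  (Flow%:E <= Fstar)%E -> (Fstar <= U%:E)%E ->
  ThetaStar !=set0 ->
  (forall theta, Theta theta -> (logint mu (fun x => 2 * L x theta)%R < +oo)%E) ->
  khat%:E = ereal_sup [set kappa mu (L ^~ theta) | theta in Theta] ->
  0 < rho < (2 * khat)^-1 ->
  Theta theta1 -> A alpha1 ->
  eucl_dist theta1 ThetaStar <= Dstar ->
  (0 < N)%N ->
  iid_with_law mu xi ->
  (\int[Pr]_w
     (F (psgd_avg_theta L g rho (Theta `*` A) eta (theta1, alpha1)
           (fun k => xi k w) N) - Fstar)
   <= (Rad * Num.sqrt (M ^+ 2 + 1) / (rho * Num.sqrt N%:R)
       + 2 * rho * khat)%R%:E)%E.

Proof.
move=> F Fstar ThetaStar A Rad eta Theta0 cTheta convT mL _ mg gL M0 gM FlowF FU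
  [thetas0 Sthetas0] phi2 khatE /andP[rho0 rhok] T1 A1 distD N0 iid.
have convTheta u v (t : R) : Theta u -> Theta v -> 0 <= t <= 1 ->
    Theta (u + t *: (v - u)) by exact: convex_set_segment.
have kk u : Theta u -> (kappa mu (L ^~ u) <= khat%:E)%E.
  by move=> Tu; rewrite khatE; apply: ereal_sup_ubound; exists u.
(* The second moment of e^L dominates the squared first moment, so kappa >= 1 at [theta1]. This
   later yields rho <= 1. *)
have khat1 : 1 <= khat.
  have := kk _ T1; rewrite (kappaE (mL _ T1) (phi2 _ T1)) lee_fin.
  apply: le_trans; rewrite ler_pdivlMr ?mul1r; first exact: moment2_ge (mL _ T1) (phi2 _ T1).
  by rewrite exprn_gt0// (moment1_gt0 (mL _ T1) (phi2 _ T1)).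
have khat0 : 0 < khat by rewrite (lt_le_trans _ khat1).
have rk : rho * khat <= 1 / 2.
  rewrite ler_pdivlMr// -mulrA (mulrC khat) ltW// -ltr_pdivlMr ?mul1r//.
  by rewrite mulr_gt0.
have rho1 : 0 < rho <= 1.
  rewrite rho0 /=; have : rho * 1 <= rho * khat by rewrite ler_pM2l.
  by lra.
have Fthetas u : ThetaStar u -> F u = Fstar.
  move=> [Tu Fu]; apply/eqP; rewrite eq_le; apply/andP; split.
    by apply: le_ereal_inf_tmp => _ [v Tv <-]; exact: Fu.
  by apply: ereal_inf_lbound; exists u.
have [fs fsE] : exists fs : R, Fstar = fs%:E.
  exists (ln (moment mu (L ^~ thetas0) 1)); rewrite -(Fthetas _ Sthetas0).
  by have [Tu _] := Sthetas0; exact: logintE (mL _ Tu) (phi2 _ Tu).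
move: FlowF FU; rewrite fsE !lee_fin => Flowfs fsU.
have rk0 : 0 < rho * khat by rewrite mulr_gt0.
pose a0 := Flow - 2 * khat * rho.
have a0fs : a0 <= fs by rewrite /a0; lra.
have a01 : a0 <= U by exact: le_trans fsU.
have Afs : A fs by rewrite /A /= in_itv/= a0fs fsU.
have Rad0 : 0 < Rad.
  rewrite sqrtr_gt0 ltr_wpDl ?sqr_ge0// exprn_gt0//; lra.
have NM0 : 0 < N%:R * (M ^+ 2 + 1) by rewrite mulr_gt0 ?ltr0n// ltr_wpDl ?sqr_ge0.
have eta0 : 0 < eta.
  by apply: divr_gt0; [exact: mulr_gt0|rewrite sqrtr_gt0].
(* The shift is c = 1 - a0, the smallest one allowed. *)
have c0 : 0 <= a0 - 1 + (1 - a0) by rewrite addrC subrKA subrr.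
have d0 : 0 < 2 * eta * N%:R.
  by apply: mulr_gt0; [apply: mulr_gt0|rewrite ltr0n].
have RadE : Rad ^+ 2 = Dstar ^+ 2 + (U - Flow + 2 * rho * khat) ^+ 2.
  by rewrite sqr_sqrtr// addr_ge0 ?sqr_ge0.
(* The stepsize balances the two terms: each equals half of the right-hand side. *)
have boundE : Rad ^+ 2 / (2 * eta * N%:R) + eta * (M ^+ 2 + 1) / (2 * rho ^+ 2) =
    Rad * Num.sqrt (M ^+ 2 + 1) / (rho * Num.sqrt N%:R).
  have sN : 0 < Num.sqrt N%:R :> R by rewrite sqrtr_gt0 ltr0n.
  have sM : 0 < Num.sqrt (M ^+ 2 + 1) by rewrite sqrtr_gt0 ltr_wpDl ?sqr_ge0.
  have -> : eta = rho * Rad / (Num.sqrt N%:R * Num.sqrt (M ^+ 2 + 1)).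
    by rewrite /eta sqrtrM ?ler0n.
  have NE : N%:R = Num.sqrt N%:R ^+ 2 :> R by rewrite sqr_sqrtr ?ler0n.
  have ME : M ^+ 2 + 1 = Num.sqrt (M ^+ 2 + 1) ^+ 2.
    by rewrite sqr_sqrtr// addr_ge0 ?sqr_ge0.
  rewrite [X in _ / (_ * X)]NE [X in _ + _ * X / _]ME.
  have balance (p q n m : R) : 0 < p -> 0 < q -> 0 < n -> 0 < m ->
      q ^+ 2 / (2 * (p * q / (n * m)) * n ^+ 2) +
        p * q / (n * m) * m ^+ 2 / (2 * p ^+ 2) = q * m / (p * n).
    by move=> p0 q0 n0 m0; field; rewrite !gt_eqF.
  exact: balance.
apply/lee_addgt0Pr => e e0.
(* A slack of 2 eta N e in the squared distance becomes e after division by 2 eta N. *)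
have [theta Stheta thetaD] := near_distance_attained
  (ex_intro _ _ Sthetas0 : ThetaStar !=set0) distD (mulr_gt0 d0 e0).
have [Ttheta _] := Stheta.
have Fmin u : Theta u -> (fs%:E <= logint mu (L ^~ u))%E.
  by move=> Tu; rewrite -fsE; apply: ereal_inf_lbound; exists u.
have := expect_gap Theta0 cTheta convTheta a01 mL mg gL gM rho1 eta0 c0 iid
  (conj T1 A1 : (Theta `*` A) (theta1, alpha1)) Ttheta Afs phi2
  (etrans (Fthetas _ Stheta) fsE) Fmin kk rk N0.
move=> /le_trans; apply; rewrite -EFinD lee_fin -boundE /=.
(* Both [alpha1] and [fs] lie in A, an interval of length U - Flow + 2 rho khat. *)
have alphaD : (alpha1 - fs) ^+ 2 <= (U - Flow + 2 * rho * khat) ^+ 2.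
  move: A1; rewrite /A /= in_itv/= => /andP[h1 h2].
  have h3 : 0 <= U - Flow + 2 * rho * khat - (alpha1 - fs).
    by move: a0fs; rewrite /a0; lra.
  have h4 : 0 <= U - Flow + 2 * rho * khat + (alpha1 - fs) by lra.
  by rewrite -subr_ge0 subr_sqr mulr_ge0.
have : (dotp (theta1 - theta) (theta1 - theta) + (alpha1 - fs) ^+ 2) /
    (2 * eta * N%:R) <= Rad ^+ 2 / (2 * eta * N%:R) + e.
  rewrite ler_pdivrMr// mulrDl divfK ?gt_eqF// RadE (mulrC e).
  by move: thetaD alphaD; lra.
by move=> h; rewrite [leRHS]addrAC [X in _ <= X + _]addrAC !lerD2r.
Qed.
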